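(* Let $G$ be a connected linear algebraic group over a field $k$ satisfying condition (L), with unipotent radical $R$ and reductive quotient $G_{\mathrm{red}}=G/R$. Let $1=R_n\subset R_{n-1}\subset\cdots\subset R_0=R$ be a linearizable splitting sequence for $R$, and for $0\le i\le n-1$ let $V_i$ be a linear representation of $G_{\mathrm{red}}$ with a $G_{\mathrm{red}}$-equivariant isomorphism $V_i\simeq R_i/R_{i+1}$. Suppose that $G$ has a Levi factor, and suppose that $$H^1(G_{\mathrm{red}},V_i)=0\quad\text{for }0\le i\le n-1.$$ Then any two Levi factors $L,L'$ of $G$ are conjugate by an element of $R(k)$.
   Context: A linear algebraic group over $k$ is a smooth affine group scheme of finite type over $k$; closed subgroups and homomorphisms are over $k$. $H^i(G_{\mathrm{red}},-)$ is the (rational) cohomology of the algebraic group, i.e. the derived functors of $V\mapsto V^{G_{\mathrm{red}}}$ on representations. The unipotent radical of $G$ is the largest connected, unipotent, normal subgroup of $G_{/k_{\mathrm{alg}}}$. Condition (R): the unipotent radical is defined over $k$, i.e. comes from a $k$-subgroup $R$ of $G$. A connected unipotent group $U$ is $k$-split if it has a chain of closed connected normal $k$-subgroups with successive quotients isomorphic to $\mathbf{G}_a$. A vector group is a connected, $k$-split, abelian, unipotent group, of exponent $p$ when $\operatorname{char}k=p>0$ (equivalently, a group isomorphic to a product of copies of $\mathbf{G}_a$). An action of an algebraic group by group automorphisms on a vector group $U$ is linearizable if there is an equivariant isomorphism between $U$ and $\operatorname{Lie}(U)$ regarded as a vector group with its natural linear action (equivalently, $U$ is equivariantly isomorphic to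 some linear representation). A splitting sequence for $R$ is a sequence $1=R_n\subset R_{n-1}\subset\cdots\subset R_0=R$ of closed connected $k$-subgroups of $R$ that are normal in $G$ and such that each $R_i/R_{i+1}$ is a vector group; the conjugation action of $G$ on each quotient then factors through $G_{\mathrm{red}}$ for the sequences considered. It is a linearizable splitting sequence if moreover $G_{\mathrm{red}}$ acts on each $R_i/R_{i+1}$ (that is, $R$ acts trivially) and this action is linearizable. Condition (L): (R) holds, $R$ is $k$-split, and $R$ has a linearizable splitting sequence. A Levi factor of $G$ is a closed $k$-subgroup $M$ such that the product map $M\ltimes R\to G$ is an isomorphism of algebraic groups over $k$. *)

(* Defs.v *)
From HB Require Import structures.
From mathcomp Require Import all_boot all_order all_algebra.
From mathcomp Require Import generic_quotient.
From mathcomp Require Import boolp classical_sets.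

Set Implicit Arguments.
Unset Strict Implicit.
Unset Printing Implicit Defensive.

Import GRing.Theory.
Local Open Scope quotient_scope.
Local Open Scope classical_set_scope.
Local Open Scope ring_scope.

(* The tensor product [M (x)_R N], as an abelian group: the formal sums
   [\sum_i m_i (x) n_i] (encoded as sequences of pairs), two of them being
   identified when no R-balanced biadditive map separates them. *)
Section Tensor.
Variables (R : comNzRingType) (M N : lmodType R).

Record balanced (W : zmodType) := Balanced {
  balanced_map :> M -> N -> W;
  balancedDl : forall m m' n,
    balanced_map (m + m') n = balanced_map m n + balanced_map m' n;
  balancedDr : forall m n n',
    balanced_map m (n + n') = balanced_map m n + balanced_map m n';
  balancedZ : forall a m n,
    balanced_map (a *: m) n = balanced_map m (a *: n) }.

Definition balanced_sum (W : zmodType) (f : balanced W) (s : seq (M * N)) : W :=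
  \sum_(p <- s) f p.1 p.2.

Definition tens_rel (s t : seq (M * N)) : bool :=
  `[< forall (W : zmodType) (f : balanced W),
        balanced_sum f s = balanced_sum f t >].

Lemma tens_rel_equiv : equiv_class_of tens_rel.
Proof.
split.
- by move=> s; apply/asboolP.
- by move=> s t; apply/asboolP/asboolP => h W f; rewrite h.
- move=> t s u /asboolP h1 /asboolP h2; apply/asboolP => W f.
  by rewrite h1 h2.
Qed.

Canonical tens_equiv := EquivRelPack tens_rel_equiv.

Definition tens : Type := {eq_quot tens_equiv}.

HB.instance Definition _ := Choice.on tens.
HB.instance Definition _ := EqQuotient.on tens.

Definition tens_of_seq (s : seq (M * N)) : tens := \pi_tens s.

Lemma tens_eqP (s t : seq (M * N)) :
  (forall (W : zmodType) (f : balanced W), balanced_sum f s = balanced_sum f t)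
  <-> tens_of_seq s = tens_of_seq t.
Proof.
split=> [h|]; first by apply/eqP; rewrite piE; apply/asboolP.
by move/eqP; rewrite piE => /asboolP.
Qed.

Lemma balanced_sum_repr (W : zmodType) (f : balanced W) s :
  balanced_sum f (repr (tens_of_seq s)) = balanced_sum f s.
Proof. by move: W f; apply/tens_eqP; rewrite /tens_of_seq reprK. Qed.

Lemma balanced0l (W : zmodType) (f : balanced W) n : f 0 n = 0.
Proof. by apply: (addrI (f 0 n)); rewrite -balancedDl !addr0. Qed.

Lemma balancedNl (W : zmodType) (f : balanced W) m n : f (- m) n = - f m n.
Proof. by apply: (addrI (f m n)); rewrite -balancedDl !subrr balanced0l. Qed.

Definition tens_opp_seq (s : seq (M * N)) := [seq (- p.1, p.2) | p <- s].

Lemma balanced_sum_cat (W : zmodType) (f : balanced W) s t :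
  balanced_sum f (s ++ t) = balanced_sum f s + balanced_sum f t.
Proof. by rewrite /balanced_sum big_cat. Qed.

Lemma balanced_sum_opp (W : zmodType) (f : balanced W) s :
  balanced_sum f (tens_opp_seq s) = - balanced_sum f s.
Proof.
rewrite /balanced_sum big_map -sumrN; apply: eq_bigr => p _ /=.
exact: balancedNl.
Qed.

Definition tens_add (x y : tens) : tens := tens_of_seq (repr x ++ repr y).
Definition tens_opp (x : tens) : tens := tens_of_seq (tens_opp_seq (repr x)).

Lemma tens_of_repr (x : tens) : tens_of_seq (repr x) = x.
Proof. exact: reprK. Qed.

Lemma tens_addA : associative tens_add.
Proof.
move=> x y z; apply/tens_eqP => W f.
by rewrite !balanced_sum_cat !balanced_sum_repr !balanced_sum_cat addrA.
Qed.
Lemma tens_addC : commutative tens_add.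
Proof.
by move=> x y; apply/tens_eqP => W f; rewrite !balanced_sum_cat addrC.
Qed.
Lemma tens_add0 : left_id (tens_of_seq [::]) tens_add.
Proof.
move=> x; rewrite -[RHS]tens_of_repr; apply/tens_eqP => W f.
by rewrite balanced_sum_cat balanced_sum_repr /balanced_sum big_nil add0r.
Qed.
Lemma tens_addN : left_inverse (tens_of_seq [::]) tens_opp tens_add.
Proof.
move=> x; apply/tens_eqP => W f.
by rewrite balanced_sum_cat balanced_sum_repr balanced_sum_opp addNr
  /balanced_sum big_nil.
Qed.

HB.instance Definition _ :=
  GRing.isZmodule.Build tens tens_addA tens_addC tens_add0 tens_addN.

Definition tensor (m : M) (n : N) : tens := tens_of_seq [:: (m, n)].
End Tensor.

Definition tens_map (R : comNzRingType) (M M' N N' : lmodType R)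
    (f : {linear M -> M'}) (g : {linear N -> N'}) (x : tens M N) : tens M' N' :=
  tens_of_seq [seq (f p.1, g p.2) | p <- repr x].

(* Restriction of scalars along a ring morphism. *)
Definition res_mod (R S : nzRingType) (f : {rmorphism R -> S})
  (M : lmodType S) : Type := M.

Section ResMod.
Variables (R S : nzRingType) (f : {rmorphism R -> S}) (M : lmodType S).
Local Notation T := (res_mod f M).
HB.instance Definition _ := GRing.Zmodule.on T.
Definition res_scale (a : R) (m : T) : T := f a *: (m : M).
Fact res_scaleA a b (v : T) : res_scale a (res_scale b v) = res_scale (a * b) v.
Proof. by rewrite /res_scale rmorphM scalerA. Qed.
Fact res_scale1 : left_id 1 res_scale.
Proof. by move=> v; rewrite /res_scale rmorph1 scale1r. Qed.
Fact res_scaleDr : right_distributive res_scale +%R.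
Proof. by move=> a u v; rewrite /res_scale scalerDr. Qed.
Fact res_scaleDl (v : T) : {morph res_scale^~ v : a b / a + b}.
Proof. by move=> a b; rewrite /res_scale rmorphD scalerDl. Qed.
HB.instance Definition _ := GRing.Zmodule_isLmodule.Build R T
  res_scaleA res_scale1 res_scaleDr res_scaleDl.
End ResMod.

Definition flat (R : comNzRingType) (N : lmodType R) : Prop :=
  forall (M M' : lmodType R) (f : {linear M -> M'}),
    injective f -> injective (tens_map (N := N) f (idfun : {linear N -> N})).

Definition faithfully_flat (R S : comNzRingType) (f : {rmorphism R -> S}) :
  Prop :=
  flat (res_mod f S^o) /\
  forall M : lmodType R,
    (forall x : tens M (res_mod f S^o), x = 0) -> forall m : M, m = 0.

Definition res_alg (k K : fieldType) (iota : {rmorphism k -> K})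
  (B : comAlgType K) : Type := B.

Section ResAlg.
Variables (k K : fieldType) (iota : {rmorphism k -> K}).
Section Obj.
Variable B : comAlgType K.
Local Notation T := (res_alg iota B).
HB.instance Definition _ := GRing.ComNzRing.on T.
HB.instance Definition _ := GRing.Lmodule.copy T (res_mod iota B).
Fact res_alg_scaleAl (a : k) (x y : T) : a *: (x * y) = (a *: x) * y.
Proof. exact: (scalerAl (iota a) (x : B) (y : B)). Qed.
HB.instance Definition _ := GRing.Lmodule_isLalgebra.Build k T res_alg_scaleAl.
HB.instance Definition _ := GRing.Lalgebra_isComAlgebra.Build k T.
End Obj.
Section Mor.
Variables (B C : comAlgType K) (f : {lrmorphism B -> C}).
Definition res_alg_map : res_alg iota B -> res_alg iota C := f.
HB.instance Definition _ := GRing.RMorphism.copy res_alg_map (f : {rmorphism B -> C}).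
Fact res_alg_map_scalable : scalable res_alg_map.
Proof. by move=> a x; exact: (linearZZ f (iota a) (x : B)). Qed.
HB.instance Definition _ := GRing.isScalable.Build k
  (res_alg iota B) (res_alg iota C) *:%R res_alg_map res_alg_map_scalable.
End Mor.
End ResAlg.

Section GroupFunctors.
Variable k : fieldType.

(* k-groups through their functors of points. The zero algebra is not a
   [comAlgType]; this loses nothing, as all k-groups have exactly one point with
   values in it. *)
Record group_functor := GroupFunctor {
  points :> comAlgType k -> groupType;
  points_map : forall B C : comAlgType k, {lrmorphism B -> C} ->
    {multiplicative points B -> points C};
  points_map_id : forall (B : comAlgType k) (x : points B),
    points_map (idfun : {lrmorphism B -> B}) x = x;
  points_map_comp : forall (B C D : comAlgType k) (f : {lrmorphism B -> C})
      (g : {lrmorphism C -> D}) (x : points B),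
    points_map (g \o f : {lrmorphism B -> D}) x
    = points_map g (points_map f x) }.

Record group_hom (G H : group_functor) := GroupHom {
  group_hom_map :> forall B : comAlgType k, {multiplicative G B -> H B};
  group_hom_natural : forall (B C : comAlgType k) (f : {lrmorphism B -> C}) (x : G B),
    group_hom_map C (points_map G f x) = points_map H f (group_hom_map B x) }.

Definition is_iso (G H : group_functor) (f : group_hom G H) : Prop :=
  forall B, bijective (f B).

Record subgroup (G : group_functor) := Subgroup {
  subpoints :> forall B : comAlgType k, set (G B);
  subpoints1 : forall B, @subpoints B 1%g;
  subpointsM : forall B x y,
    @subpoints B x -> @subpoints B y -> @subpoints B (x * y)%g;
  subpointsV : forall B x, @subpoints B x -> @subpoints B (x^-1)%g;
  subpoints_map : forall (B C : comAlgType k) (f : {lrmorphism B -> C}) x,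
    @subpoints B x -> @subpoints C (points_map G f x) }.
Arguments subpoints {G} s B _.

Section SubgroupFunctor.
Variables (G : group_functor) (H : subgroup G).
Section Points.
Variable B : comAlgType k.
Definition sub_pred : pred (G B) := fun x => `[< H B x >].
Definition sub_type : Type := {x : G B | sub_pred x}.
HB.instance Definition _ := [isSub of sub_type for @sval _ _].
HB.instance Definition _ := [Choice of sub_type by <:].
Definition sub_elt (x : G B) (hx : H B x) : sub_type :=
  exist _ x (asboolT hx).
Lemma sub_eltP (x : sub_type) : H B (val x).
Proof. exact: asboolW (valP x). Qed.
Definition sub_one : sub_type := sub_elt (subpoints1 H B).
Definition sub_mul (x y : sub_type) : sub_type :=
  sub_elt (subpointsM (sub_eltP x) (sub_eltP y)).
Definition sub_inv (x : sub_type) : sub_type := sub_elt (subpointsV (sub_eltP x)).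
Fact sub_mulA : associative sub_mul.
Proof. by move=> x y z; apply: val_inj; exact: mulgA. Qed.
Fact sub_mul1 : left_id sub_one sub_mul.
Proof. by move=> x; apply: val_inj; exact: mul1g. Qed.
Fact sub_mulr1 : right_id sub_one sub_mul.
Proof. by move=> x; apply: val_inj; exact: mulg1. Qed.
Fact sub_mulV : left_inverse sub_one sub_inv sub_mul.
Proof. by move=> x; apply: val_inj; exact: mulVg. Qed.
Fact sub_mulgV : right_inverse sub_one sub_inv sub_mul.
Proof. by move=> x; apply: val_inj; exact: mulgV. Qed.
HB.instance Definition _ := isGroup.Build sub_type
  sub_mulA sub_mul1 sub_mulr1 sub_mulV sub_mulgV.
End Points.
Definition sub_map (B C : comAlgType k) (f : {lrmorphism B -> C})
    (x : sub_type B) : sub_type C :=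
  sub_elt (subpoints_map f (sub_eltP x)).
Fact sub_map_mul B C f : {morph @sub_map B C f : x y / (x * y)%g}.
Proof. by move=> x y; apply: val_inj; exact: gmulfM. Qed.
HB.instance Definition _ B C f :=
  isMultiplicative.Build _ _ (@sub_map B C f) (sub_map_mul f).
Program Definition sub_functor : group_functor :=
  @GroupFunctor (fun B => sub_type B) (fun B C f => @sub_map B C f) _ _.
Next Obligation. by apply: val_inj; exact: points_map_id. Qed.
Next Obligation. by apply: val_inj; exact: points_map_comp. Qed.
End SubgroupFunctor.
End GroupFunctors.

Lemma lrmorphism_eq (k : fieldType) (B C : comAlgType k)
    (f g : {lrmorphism B -> C}) : f =1 g -> f = g.
Proof.
case: f g => [f cf] [g cg] /= /funext e; move: cf cg; rewrite /= in e *.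
case: g / e => cf cg; congr GRing.LRMorphism.Pack.
case: cf => -[a] [b] [c]; case: cg => -[a'] [b'] [c'].
by rewrite (Prop_irrelevance a a') (Prop_irrelevance b b')
  (Prop_irrelevance c c').
Qed.

Section TensorMap.
Variables (R : comNzRingType).

Section Comp.
Variables (M M' N N' : lmodType R) (f : {linear M -> M'}) (g : {linear N -> N'}).

Section Balanced.
Variables (W : zmodType) (h : balanced M' N' W).
Fact tens_map_balancedDl m m' n :
  h (f (m + m')) (g n) = h (f m) (g n) + h (f m') (g n).
Proof. by rewrite raddfD balancedDl. Qed.
Fact tens_map_balancedDr m n n' :
  h (f m) (g (n + n')) = h (f m) (g n) + h (f m) (g n').
Proof. by rewrite raddfD balancedDr. Qed.
Fact tens_map_balancedZ a m n : h (f (a *: m)) (g n) = h (f m) (g (a *: n)).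
Proof. by rewrite !linearZZ balancedZ. Qed.
Definition balanced_comp : balanced M N W :=
  Balanced tens_map_balancedDl tens_map_balancedDr tens_map_balancedZ.
End Balanced.

Lemma tens_map_seq s :
  tens_map f g (tens_of_seq s) = tens_of_seq [seq (f p.1, g p.2) | p <- s].
Proof.
apply/tens_eqP => W h; rewrite /balanced_sum !big_map.
exact: (balanced_sum_repr (balanced_comp h)).
Qed.

Lemma tens_mapD x y : tens_map f g (x + y) = tens_map f g x + tens_map f g y.
Proof.
have e : tens_map f g (x + y)
  = tens_of_seq ([seq (f p.1, g p.2) | p <- repr x]
                   ++ [seq (f p.1, g p.2) | p <- repr y]).
  by rewrite -map_cat -tens_map_seq.
rewrite e; apply/tens_eqP => W h.
by rewrite !balanced_sum_cat !balanced_sum_repr.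
Qed.
End Comp.

Lemma tens_map_id (M N : lmodType R) (x : tens M N) :
  tens_map (idfun : {linear M -> M}) (idfun : {linear N -> N}) x = x.
Proof.
rewrite -[x]tens_of_repr tens_map_seq -[in RHS](map_id (repr x)).
by congr tens_of_seq; apply: eq_map => -[].
Qed.

Lemma tens_map_comp (M M' M'' N N' N'' : lmodType R)
    (f : {linear M -> M'}) (f' : {linear M' -> M''})
    (g : {linear N -> N'}) (g' : {linear N' -> N''}) (x : tens M N) :
  tens_map (f' \o f : {linear M -> M''}) (g' \o g : {linear N -> N''}) x
  = tens_map f' g' (tens_map f g x).
Proof. by rewrite -[x]tens_of_repr !tens_map_seq -map_comp. Qed.
End TensorMap.

(* A zmodType, its addition being written multiplicatively. *)
Definition additive_group (V : zmodType) : Type := V.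

Section AdditiveGroup.
Variable V : zmodType.
HB.instance Definition _ := Choice.on (additive_group V).
HB.instance Definition _ := isGroup.Build (additive_group V)
  (@addrA V) (@add0r V) (@addr0 V) (@addNr V) (@addrN V).
End AdditiveGroup.

Section Algebraic.
Variable k : fieldType.

Section Vect.
Variable V : lmodType k.
Definition vect_map (B C : comAlgType k) (f : {lrmorphism B -> C}) :
    additive_group (tens V B) -> additive_group (tens V C) :=
  tens_map (idfun : {linear V -> V}) (f : {linear B -> C}).
Fact vect_map_mul B C f : {morph @vect_map B C f : x y / (x * y)%g}.
Proof. by move=> x y; exact: tens_mapD. Qed.
HB.instance Definition _ B C f :=
  isMultiplicative.Build _ _ (@vect_map B C f) (vect_map_mul f).
Fact vect_map_id (B : comAlgType k) x :
  vect_map (idfun : {lrmorphism B -> B}) x = x.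
Proof. exact: tens_map_id. Qed.
Fact vect_map_comp (B C D : comAlgType k) (f : {lrmorphism B -> C})
    (g : {lrmorphism C -> D}) x :
  vect_map (g \o f : {lrmorphism B -> D}) x = vect_map g (vect_map f x).
Proof. by rewrite /vect_map -tens_map_comp. Qed.
(* [V] as an additive k-group: its B-points are [V (x)_k B]. *)
Definition vect_functor : group_functor k :=
  @GroupFunctor k (fun B => additive_group (tens V B))
    (fun B C f => @vect_map B C f) vect_map_id vect_map_comp.
End Vect.

Definition Ga_map (B C : comAlgType k) (f : {lrmorphism B -> C}) :
  additive_group B -> additive_group C := f.
Fact Ga_map_mul B C f : {morph @Ga_map B C f : x y / (x * y)%g}.
Proof. by move=> x y; exact: (raddfD f). Qed.
HB.instance Definition _ B C f :=
  isMultiplicative.Build _ _ (@Ga_map B C f) (Ga_map_mul f).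
Definition Ga : group_functor k :=
  @GroupFunctor k (fun B => additive_group B) (fun B C f => @Ga_map B C f)
    (fun _ _ => erefl) (fun _ _ _ _ _ _ => erefl).

Definition struct_map (B : comAlgType k) : k^o -> B := in_alg B.
HB.instance Definition _ (B : comAlgType k) :=
  GRing.RMorphism.copy (@struct_map B) (in_alg B : {rmorphism k -> B}).
Fact struct_map_scalable B : scalable (@struct_map B).
Proof. by move=> a x; rewrite /struct_map /= scalerA. Qed.
HB.instance Definition _ (B : comAlgType k) := GRing.isScalable.Build k k^o B
  *:%R (@struct_map B) (@struct_map_scalable B).

(* [u] is the universal point: [G] is represented by the algebra [A]. *)
Definition represents (G : group_functor k) (A : comAlgType k) (u : G A) : Prop :=
  forall (B : comAlgType k) (x : G B),
    exists f : {lrmorphism A -> B}, points_map G f u = x /\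
      forall g : {lrmorphism A -> B}, points_map G g u = x -> g =1 f.

Section Groups.
Variable G : group_functor k.

Definition finitely_generated (A : comAlgType k) : Prop :=
  exists s : seq A, forall S : {pred A},
    subalg_closed S -> {subset s <= S} -> forall a, a \in S.

Definition affine_finite_type : Prop :=
  exists (A : comAlgType k) (u : G A), represents u /\ finitely_generated A.

(* Infinitesimal lifting criterion (EGA IV 17.3.1). *)
Definition smooth : Prop :=
  forall (B C : comAlgType k) (f : {lrmorphism B -> C}),
    (forall c, exists b, f b = c) ->
    (forall a b, f a = 0 -> f b = 0 -> a * b = 0) ->
    forall y : G C, exists x : G B, points_map G f x = y.

Definition linear_algebraic_group : Prop := affine_finite_type /\ smooth.

(* The spectrum of the coordinate algebra is connected. *)
Definition connected_group : Prop :=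
  exists (A : comAlgType k) (u : G A),
    represents u /\ forall e : A, e * e = e -> e = 0 \/ e = 1.

Definition abelian_group : Prop := forall B (x y : G B), (x * y = y * x)%g.

(* Pulled back along any point [x : Spec B -> G], the subfunctor [H] is the
   closed subscheme of [Spec B] cut out by (the ideal generated by) [I]. *)
Definition closed_subgroup (H : subgroup G) : Prop :=
  forall (B : comAlgType k) (x : G B), exists I : set B,
    forall (C : comAlgType k) (f : {lrmorphism B -> C}),
      H C (points_map G f x) <-> forall b, I b -> f b = 0.

Definition normal_subgroup (H : subgroup G) : Prop :=
  forall B (g x : G B), H B x -> H B (g * x * g^-1)%g.

Definition sub_subgroup (H N : subgroup G) : Prop :=
  forall B (x : G B), H B x -> N B x.

Definition trivial_subgroup (H : subgroup G) : Prop :=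
  forall B (x : G B), H B x <-> x = 1%g.

(* [N], viewed as a subgroup of [H]. *)
Program Definition subgroup_in (H N : subgroup G) : subgroup (sub_functor H) :=
  @Subgroup k (sub_functor H) (fun B x => N B (val x)) _ _ _ _.
Next Obligation. exact: subpoints1. Qed.
Next Obligation. exact: subpointsM. Qed.
Next Obligation. exact: subpointsV. Qed.
Next Obligation. exact: subpoints_map. Qed.

Definition faithfully_flat_hom (Q : group_functor k) (q : group_hom G Q) : Prop :=
  exists (A : comAlgType k) (u : G A) (C : comAlgType k) (w : Q C)
    (f : {lrmorphism C -> A}),
    [/\ represents u, represents w, points_map Q f w = q A u
      & faithfully_flat f].

(* The quotient [G / N]: a faithfully flat homomorphism with kernel [N]. *)
Definition is_quotient (Q : group_functor k) (q : group_hom G Q) (N : subgroup G) :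
  Prop :=
  faithfully_flat_hom q /\ forall B (x : G B), q B x = 1%g <-> N B x.

Record representation := Representation {
  rep_space :> lmodType k;
  rep_act : forall B : comAlgType k,
    G B -> {additive tens rep_space B -> tens rep_space B};
  rep_act_scale : forall (B : comAlgType k) (g : G B) (b : B) x,
    rep_act g (tens_map (idfun : {linear rep_space -> rep_space})
                 (b \*o idfun : {linear B -> B}) x)
    = tens_map (idfun : {linear rep_space -> rep_space})
        (b \*o idfun : {linear B -> B}) (rep_act g x);
  rep_act1 : forall (B : comAlgType k) x, rep_act (1%g : G B) x = x;
  rep_actM : forall (B : comAlgType k) (g h : G B) x,
    rep_act (g * h)%g x = rep_act g (rep_act h x);
  rep_act_map : forall (B C : comAlgType k) (f : {lrmorphism B -> C}) (g : G B) x,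
    tens_map (idfun : {linear rep_space -> rep_space}) (f : {linear B -> C})
      (rep_act g x)
    = rep_act (points_map G f g)
        (tens_map (idfun : {linear rep_space -> rep_space})
           (f : {linear B -> C}) x) }.

Record rep_hom (V W : representation) := RepHom {
  rep_hom_map :> {linear V -> W};
  rep_hom_act : forall (B : comAlgType k) (g : G B) x,
    tens_map rep_hom_map (idfun : {linear B -> B}) (rep_act V g x)
    = rep_act W g (tens_map rep_hom_map (idfun : {linear B -> B}) x) }.

Definition invariant (V : representation) (v : V) : Prop :=
  forall (B : comAlgType k) (g : G B),
    rep_act V g (tensor v (1 : B)) = tensor v (1 : B).

Definition unipotent : Prop :=
  forall V : representation, (exists v : V, v != 0) ->
    exists v : V, v != 0 /\ invariant v.

Definition injective_rep (I : representation) : Prop :=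
  forall (M N : representation) (i : rep_hom M N) (f : rep_hom M I),
    injective i -> exists g : rep_hom N I, forall m, g (i m) = f m.

Record injective_resolution (V : representation) := InjectiveResolution {
  res_term : nat -> representation;
  res_aug : rep_hom V (res_term 0);
  res_d : forall i, rep_hom (res_term i) (res_term i.+1);
  res_injective : forall i, injective_rep (res_term i);
  res_aug_inj : injective res_aug;
  res_exact0 : forall x, res_d 0 x = 0 <-> exists v, res_aug v = x;
  res_exact : forall i x, res_d i.+1 x = 0 <-> exists y, res_d i y = x }.

Definition cocycle (V : representation) (I : injective_resolution V) (n : nat)
    (x : res_term I n) : Prop :=
  invariant x /\ res_d I n x = 0.

Definition coboundary (V : representation) (I : injective_resolution V)
    (n : nat) : res_term I n -> Prop :=
  match n with
  | 0 => fun x => x = 0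
  | m.+1 => fun x => exists y : res_term I m, invariant y /\ res_d I m y = x
  end.

(* [H^n(G, V) = 0], where [H^n(G, -)] is the n-th right derived functor of
   [V |-> V^G], computed on an injective resolution (they all give the same
   result). *)
Definition cohomology_vanishes (n : nat) (V : representation) : Prop :=
  exists I : injective_resolution V,
    forall x : res_term I n, cocycle x -> coboundary x.
End Groups.

Definition k_split (U : group_functor k) : Prop :=
  [/\ connected_group U, unipotent U
    & exists (n : nat) (S : nat -> subgroup U),
      [/\ forall B (x : U B), S 0 B x, trivial_subgroup (S n),
          forall i, (i <= n)%N ->
            [/\ closed_subgroup (S i), connected_group (sub_functor (S i))
              & normal_subgroup (S i)],
          forall i, (i < n)%N -> sub_subgroup (S i.+1) (S i)
        & forall i, (i < n)%N ->
            exists q : group_hom (sub_functor (S i)) Ga,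
              is_quotient q (subgroup_in (S i) (S i.+1))]].

Definition vector_group (U : group_functor k) : Prop :=
  [/\ linear_algebraic_group U /\ connected_group U, k_split U,
      abelian_group U, unipotent U
    & forall p : nat, p \in [pchar k] ->
        forall (B : comAlgType k) (x : U B), (x ^+ p = 1)%g].

(* An action of [H] on [U] by group automorphisms. *)
Record group_action (H U : group_functor k) := GroupAction {
  action_map :> forall B : comAlgType k, H B -> {multiplicative U B -> U B};
  action1 : forall (B : comAlgType k) x, action_map (1%g : H B) x = x;
  actionM : forall (B : comAlgType k) (g h : H B) x,
    action_map (g * h)%g x = action_map g (action_map h x);
  action_natural : forall (B C : comAlgType k) (f : {lrmorphism B -> C})
      (h : H B) (x : U B),
    points_map U f (action_map h x)
    = action_map (points_map H f h) (points_map U f x) }.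

Definition equivariant_iso (H U : group_functor k) (a : group_action H U)
    (V : representation H) (phi : group_hom (vect_functor V) U) : Prop :=
  is_iso phi /\
  forall (B : comAlgType k) (h : H B) (x : tens V B),
    phi B (rep_act V h x : vect_functor V B)
    = a B h (phi B (x : vect_functor V B)).

Definition linearizable (H U : group_functor k) (a : group_action H U) : Prop :=
  exists (V : representation H) (phi : group_hom (vect_functor V) U),
    equivariant_iso a phi.

Section Extension.
Variables (G : group_functor k) (R : subgroup G).

Record splitting_sequence := SplittingSequence {
  ss_length : nat;
  ss_term : nat -> subgroup G;
  ss_first : forall B (x : G B), ss_term 0 B x <-> R B x;
  ss_last : trivial_subgroup (ss_term ss_length);
  ss_closed : forall i, (i <= ss_length)%N -> closed_subgroup (ss_term i);
  ss_connected : forall i, (i <= ss_length)%N ->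
    connected_group (sub_functor (ss_term i));
  ss_normal : forall i, (i <= ss_length)%N -> normal_subgroup (ss_term i);
  ss_decr : forall i, (i < ss_length)%N ->
    sub_subgroup (ss_term i.+1) (ss_term i);
  ss_quot : 'I_ss_length -> group_functor k;
  ss_proj : forall i : 'I_ss_length, group_hom (sub_functor (ss_term i)) (ss_quot i);
  ss_quotient : forall i : 'I_ss_length,
    is_quotient (ss_proj i) (subgroup_in (ss_term i) (ss_term i.+1));
  ss_vector : forall i : 'I_ss_length, vector_group (ss_quot i) }.

Arguments ss_quot : clear implicits.
Arguments ss_proj : clear implicits.

(* [lss_action_conj] says that the action of [G] on [R_i / R_i+1] induced by
   conjugation is the composite of [pi] and of [lss_action i]. *)
Record linearizable_splitting_sequence (Gred : group_functor k)
    (pi : group_hom G Gred) := LinearizableSplittingSequence {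
  lss_seq :> splitting_sequence;
  lss_action : forall i : 'I_(ss_length lss_seq),
    group_action Gred (ss_quot lss_seq i);
  lss_action_conj : forall (i : 'I_(ss_length lss_seq)) (B : comAlgType k)
      (g : G B) (x y : sub_functor (ss_term lss_seq i) B),
    val y = (g * val x * g^-1)%g ->
    lss_action i B (pi B g) (ss_proj lss_seq i B x) = ss_proj lss_seq i B y;
  lss_linearizable : forall i, linearizable (lss_action i) }.

(* Multiplication [M x R -> G] is a homomorphism from the semidirect product as
   soon as [R] is normal; it is an isomorphism iff it is bijective on points. *)
Definition levi_factor (M : subgroup G) : Prop :=
  closed_subgroup M /\
  forall B : comAlgType k,
    bijective (fun p : sub_functor M B * sub_functor R B =>
                 (val p.1 * val p.2)%g : G B).
End Extension.

(* [L' = r L r^-1]. *)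
Definition conjugate_by (G : group_functor k) (r : G k^o) (L L' : subgroup G) :
  Prop :=
  forall (B : comAlgType k) (x : G B),
    let rB := points_map G (@struct_map B : {lrmorphism k^o -> B}) r in
    L B x <-> L' B (rB * x * rB^-1)%g.
End Algebraic.

Arguments ss_quot {k G R} s i.
Arguments ss_proj {k G R} s i.
Arguments lss_action {k G R Gred pi} l i.

Section BaseChange.
Variables (k K : fieldType) (iota : {rmorphism k -> K}).

Program Definition base_change (G : group_functor k) : group_functor K :=
  @GroupFunctor K (fun B => G (res_alg iota B))
    (fun B C f => points_map G
       (@res_alg_map k K iota B C f : {lrmorphism res_alg iota B -> res_alg iota C}))
    _ _.
Next Obligation.
rewrite -[RHS]points_map_id; congr (points_map G _ x); exact: lrmorphism_eq.
Qed.
Next Obligation.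
rewrite -points_map_comp; congr (points_map G _ x); exact: lrmorphism_eq.
Qed.

Program Definition sub_base_change (G : group_functor k) (H : subgroup G) :
    subgroup (base_change G) :=
  @Subgroup K (base_change G) (fun B x => H (res_alg iota B) x) _ _ _ _.
Next Obligation. exact: subpoints1. Qed.
Next Obligation. exact: subpointsM. Qed.
Next Obligation. exact: subpointsV. Qed.
Next Obligation. exact: subpoints_map. Qed.
End BaseChange.

Definition is_algebraic_closure (k : fieldType) (K : closedFieldType)
    (iota : {rmorphism k -> K}) : Prop :=
  forall x : K, algebraicOver iota x.

Definition smooth_connected_unipotent_normal (k : fieldType)
    (G : group_functor k) (N : subgroup G) : Prop :=
  [/\ closed_subgroup N, normal_subgroup N,
      linear_algebraic_group (sub_functor N), connected_group (sub_functor N)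
    & unipotent (sub_functor N)].

Definition is_unipotent_radical (k : fieldType) (G : group_functor k)
    (N : subgroup G) : Prop :=
  smooth_connected_unipotent_normal N /\
  forall N' : subgroup G, smooth_connected_unipotent_normal N' ->
    sub_subgroup N' N.

(* Condition (R), [R] being the subgroup of [G] which gives the unipotent
   radical over the algebraic closure [K] of [k]. *)
Definition condition_R (k : fieldType) (K : closedFieldType)
    (iota : {rmorphism k -> K}) (G : group_functor k) (R : subgroup G) : Prop :=
  closed_subgroup R /\ is_unipotent_radical (sub_base_change iota R).

Definition condition_L (k : fieldType) (K : closedFieldType)
    (iota : {rmorphism k -> K}) (G : group_functor k) (R : subgroup G)
    (Gred : group_functor k) (pi : group_hom G Gred) : Prop :=
  [/\ condition_R iota R, k_split (sub_functor R)
    & inhabited (linearizable_splitting_sequence R pi)].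

(* Main.v *)
Require Import Defs.
From HB Require Import structures.
From mathcomp Require Import all_boot all_order all_algebra.
From mathcomp Require Import generic_quotient.
From mathcomp Require Import boolp classical_sets.

(** Write [sigma] for the inverse of [L ~ Gred]: a Levi factor is the same thing
    as a homomorphic section of [pi : G -> Gred], and conjugating Levi factors by
    [R(k)] is conjugating sections. For two sections [sigma], [sigma'] one climbs
    down the splitting sequence. Suppose that [r] in [R(k)] makes [sigma'] and
    [r sigma r^-1] agree modulo [R_i]. The discrepancy
    [d(y) = sigma'(y) (r sigma(y) r^-1)^-1] satisfies
    [d(yz) = d(y) (t d(z) t^-1)] with [t = r sigma(y) r^-1] above [y], hence its
    class in [R_i / R_(i+1) ~ V_i] is a crossed homomorphism [Gred -> V_i]. As
    [H^1(Gred, V_i) = 0], it is [y |-> y v - v] for some [v] in [V_i]; if [s] in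
    [R_i(k)] lifts [v], then [s^-1 r] makes the two sections agree modulo
    [R_(i+1)] ([conjugate_step]). At the end of the sequence the sections are
    equal.

    Three points need an argument.

    - A Levi factor [L] meets [ker pi = R] trivially and the [L]-part of a point
      of [G] depends only on its image in [Gred]. Surjectivity of [L -> Gred] on
      points over every algebra comes from descent: the [L]-part of the universal
      point of [G] has equal pullbacks along any two maps that agree on the
      algebra of [Gred], over which the algebra of [G] is faithfully flat
      ([levi_surj]). Descent itself rests on [faithfully_flat_image], and makes
      use of the tensor product of algebras [tens_alg].

    - A crossed homomorphism [c] with values in [V] defines an extension
      [V + k] of the trivial representation by [V]. Extending [V -> I_0] to this
      extension, the image of [(0, 1)] is an element [x] of [I_0] with
      [g x - x = c(g)], whose differential is an invariant cocycle of degree 1.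
      If that is the differential of an invariant [y], then [x - y] comes from an
      element [v] of [V] and [c(g) = g v - v] ([crossed_hom_principal]).

    - The map [R_i(k) -> V_i] is onto because [R_(i+1)] is an iterated extension
      of vector groups, whose torsors over a field are trivial. Concretely, [v]
      lifts to a point [t] over some algebra [F]; the ratio of the two pullbacks
      of [t] to [F (x) F] measures how far [t] is from being rational. If the ratio
      lies in [R_j], its class in [V_j (x) F (x) F] is an additive Cech cocycle,
      thus a coboundary, since a linear form on [F] with value 1 at 1 contracts
      the Cech complex. After enlarging [F] one corrects [t] by a point of [R_j],
      which pushes the ratio into [R_(j+1)] ([almost_rational_next]). Allowing [F]
      to grow at each step avoids lifting points over a fixed [F]. When the ratio
      is trivial, [t] descends to [k] ([rational_lift]). *)

Set Implicit Arguments.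
Unset Strict Implicit.
Unset Printing Implicit Defensive.

Import GRing.Theory.
Local Open Scope quotient_scope.
Local Open Scope classical_set_scope.
Local Open Scope ring_scope.

(** * Tensor products *)

Section TensorTheory.
Variables (R : comNzRingType) (M N : lmodType R).
Implicit Types (m : M) (n : N) (x y : tens M N).

Definition tens_lift (W : zmodType) (f : balanced M N W) x : W :=
  balanced_sum f (repr x).

Lemma tens_lift_tensor (W : zmodType) (f : balanced M N W) m n :
  tens_lift f (tensor m n) = f m n.
Proof. by rewrite /tens_lift balanced_sum_repr /balanced_sum big_seq1. Qed.

Lemma tens_of_seqD (s t : seq (M * N)) :
  tens_of_seq (s ++ t) = tens_of_seq s + tens_of_seq t.
Proof.
by apply/tens_eqP => W f; rewrite !balanced_sum_cat !balanced_sum_repr.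
Qed.

Lemma tens_liftD (W : zmodType) (f : balanced M N W) x y :
  tens_lift f (x + y) = tens_lift f x + tens_lift f y.
Proof. by rewrite /tens_lift balanced_sum_repr balanced_sum_cat. Qed.

Lemma tensorDl m m' n : tensor (m + m') n = tensor m n + tensor m' n.
Proof.
rewrite -tens_of_seqD; apply/tens_eqP => W f.
by rewrite /balanced_sum !big_cons !big_nil /= balancedDl addrA.
Qed.

Lemma tensorDr m n n' : tensor m (n + n') = tensor m n + tensor m n'.
Proof.
rewrite -tens_of_seqD; apply/tens_eqP => W f.
by rewrite /balanced_sum !big_cons !big_nil /= balancedDr addrA.
Qed.

Lemma tensorZ a m n : tensor (a *: m) n = tensor m (a *: n).
Proof. by apply/tens_eqP => W f; rewrite /balanced_sum !big_seq1 balancedZ. Qed.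

Definition tensor_balanced := Balanced tensorDl tensorDr tensorZ.

Lemma tensor0l n : tensor 0 n = 0 :> tens M N.
Proof. by have := balanced0l tensor_balanced n. Qed.

Lemma tensorr0 m : tensor m 0 = 0 :> tens M N.
Proof. by apply: (addrI (tensor m 0)); rewrite -tensorDr !addr0. Qed.

Lemma tens_ind (P : tens M N -> Prop) :
  (forall m n, P (tensor m n)) -> P 0 ->
  (forall x y, P x -> P y -> P (x + y)) -> forall x, P x.
Proof.
move=> Pt P0 PD x; rewrite -[x]tens_of_repr; elim: (repr x) => [//|[m n] s IHs].
by rewrite -[_ :: s]cat1s tens_of_seqD; apply: PD => //; exact: Pt.
Qed.

Lemma additive0 (U W : zmodType) (f : U -> W) : {morph f : x y / x + y} -> f 0 = 0.
Proof. by move=> fD; apply: (addrI (f 0)); rewrite -fD !addr0. Qed.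

(** Additive maps out of a tensor product are determined by the pure tensors. *)
Lemma tens_ext (W : zmodType) (f g : tens M N -> W) :
  {morph f : x y / x + y} -> {morph g : x y / x + y} ->
  (forall m n, f (tensor m n) = g (tensor m n)) -> f =1 g.
Proof.
move=> fD gD efg; apply: tens_ind => //; first by rewrite !additive0.
by move=> x y ex ey; rewrite fD gD ex ey.
Qed.
End TensorTheory.

Section TensorMapTheory.
Variables (R : comNzRingType).

Lemma tens_map_tensor (M M' N N' : lmodType R)
    (f : {linear M -> M'}) (g : {linear N -> N'}) m n :
  tens_map f g (tensor m n) = tensor (f m) (g n).
Proof. exact: tens_map_seq. Qed.

Lemma tens_map0 (M M' N N' : lmodType R)
    (f : {linear M -> M'}) (g : {linear N -> N'}) : tens_map f g 0 = 0.
Proof. by apply: additive0 => x y; rewrite tens_mapD. Qed.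

Lemma tens_mapN (M M' N N' : lmodType R)
    (f : {linear M -> M'}) (g : {linear N -> N'}) x :
  tens_map f g (- x) = - tens_map f g x.
Proof. by apply: (addrI (tens_map f g x)); rewrite -tens_mapD !subrr tens_map0. Qed.

Lemma tens_mapB (M M' N N' : lmodType R)
    (f : {linear M -> M'}) (g : {linear N -> N'}) x y :
  tens_map f g (x - y) = tens_map f g x - tens_map f g y.
Proof. by rewrite tens_mapD tens_mapN. Qed.

Lemma eq_tens_map (M M' N N' : lmodType R)
    (f f' : {linear M -> M'}) (g g' : {linear N -> N'}) :
  f =1 f' -> g =1 g' -> tens_map f g =1 tens_map f' g'.
Proof.
move=> ef eg; apply: tens_ext; try exact: tens_mapD.
by move=> m n; rewrite !tens_map_tensor ef eg.
Qed.

End TensorMapTheory.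

Lemma linear_exists (R : nzRingType) (U V : lmodType R) (f : U -> V) :
  linear f -> exists g : {linear U -> V}, g =1 f.
Proof.
move=> lin_f; pose fL := GRing.isLinear.Build R U V *:%R f lin_f.
by exists (HB.pack f fL : {linear U -> V}).
Qed.

(** * Linear retractions *)

(** A subspace of [W] maximal among those meeting the image of [i] trivially
    is a complement of that image, and projecting along it inverts [i]. *)
Lemma linear_retraction (k : fieldType) (V W : lmodType k) (i : {linear V -> W}) :
  injective i -> exists r : {linear W -> V}, forall v, r (i v) = v.
Proof.
move=> inj_i.
(* The zero vector is required of nonempty sets only, so that the union of the
   empty chain is admissible. *)
pose P (A : set W) := (forall a u v, A u -> A v -> A (a *: u + v))
  /\ (forall v, A (i v) -> v = 0).
have [|A [[PA iA] maxA]] := @Zorn_bigcup W P.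
  move=> F FP Ftot; split=> [a u v [X FX Xu] [Y FY Yv]|v [X FX Xv]]; last first.
    by have [_] := FP _ FX; apply.
  have [XY|YX] := Ftot _ _ FX FY.
    by exists Y => //; have [+ _] := FP _ FY; apply => //; exact: XY.
  by exists X => //; have [+ _] := FP _ FX; apply => //; exact: YX.
have A0 : A 0.
  apply: contrapT => nA0; apply: (maxA [set 0]).
    split=> [x Ax|/(_ _ erefl)//]; case: nA0.
    by rewrite -(subrr x) addrC -scaleN1r; apply: PA.
  split=> [a u v -> ->|v /= iv0]; first by rewrite /= scaler0 addr0.
  by apply: inj_i; rewrite iv0 raddf0.
have AZ a u : A u -> A (a *: u) by move=> Au; rewrite -[_ *: _]addr0; exact: PA.
have AD u v : A u -> A v -> A (u + v).
  by move=> Au Av; rewrite -[u]scale1r; exact: PA.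
have dec w : exists v, A (w - i v).
  apply: contrapT => nw.
  pose B := [set u + a *: w | u in A & a in [set: k]].
  apply: (maxA B).
    split=> [u Au|BA]; first by exists u => //; exists 0 => //; rewrite scale0r addr0.
    case: nw; exists 0; rewrite raddf0 subr0; apply: BA.
    by exists 0 => //; exists 1 => //; rewrite add0r scale1r.
  split.
    move=> a _ _ [u Au [b _ <-]] [v Av [c _ <-]].
    exists (a *: u + v); first exact: PA.
    by exists (a * b + c) => //; rewrite scalerDr scalerDl scalerA addrACA.
  move=> v [u Au [a _]]; have [->|a0] := eqVneq a 0.
    by rewrite scale0r addr0 => uv; apply: iA; rewrite -uv.
  move=> uv; case: nw; exists (a^-1 *: v).
  have -> : w - i (a^-1 *: v) = - a^-1 *: u.
    rewrite linearZZ -uv scalerDr scalerA mulVf // scale1r opprD addrCA subrr.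
    by rewrite addr0 scaleNr.
  exact: AZ.
have [r rP] := choice dec.
have r_uniq w v : A (w - i v) -> r w = v.
  move=> Av; apply/eqP; rewrite -subr_eq0; apply/eqP/iA.
  rewrite raddfB.
  have -> : i (r w) - i v = - 1 *: (w - i (r w)) + (w - i v).
    by rewrite scaleN1r opprB addrA subrK.
  exact: PA.
have lin_r : linear r.
  move=> a u v; apply: r_uniq; rewrite linearP.
  have -> : a *: u + v - (a *: i (r u) + i (r v))
     = a *: (u - i (r u)) + (v - i (r v)).
    by rewrite scalerBr opprD addrACA.
  exact: PA.
have [r' r'E] := linear_exists lin_r.
by exists r' => v; rewrite r'E; apply: r_uniq; rewrite subrr.
Qed.

(** * Tensor products of algebras *)

Lemma lrmorphism_exists (k : fieldType) (B D : comAlgType k) (h : B -> D) :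
  {morph h : x y / x + y} -> {morph h : x y / x * y} -> h 1 = 1 ->
  (forall a x, h (a *: x) = a *: h x) -> exists h' : {lrmorphism B -> D}, h' =1 h.
Proof.
move=> hD hM h1 hZ.
have lin_h : linear h by move=> a x y; rewrite hD hZ.
pose hL := GRing.isLinear.Build k B D *:%R h lin_h.
pose hR := GRing.isMonoidMorphism.Build B D h (h1, hM).
by exists (HB.pack h hL hR : {lrmorphism B -> D}).
Qed.

Section TensorAlgebra.
Variables (k : fieldType) (C X Y : comAlgType k).
Variables (f : {lrmorphism C -> X}) (g : {lrmorphism C -> Y}).

Local Notation M := (res_mod (f : {rmorphism C -> X}) X^o).
Local Notation N := (res_mod (g : {rmorphism C -> Y}) Y^o).
Local Notation T := (tens M N).
Local Notation "x (x) y" := (tensor (x : M) (y : N))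
  (at level 40, no associativity).

Lemma tensor_alg_balance c x y : (f c * x) (x) y = x (x) (g c * y).
Proof. exact: (tensorZ c (x : M) (y : N)). Qed.

(** The product is obtained by applying the universal property twice: first in
    the right factor, with a pure tensor on the left, then in the left one. *)
Section PureMul.
Variables (x : X) (y : Y).
Fact pure_mulDl (x1 x2 : M) (y1 : N) :
  (x * (x1 + x2)) (x) (y * y1) = (x * x1) (x) (y * y1) + (x * x2) (x) (y * y1).
Proof. by rewrite mulrDr; exact: tensorDl. Qed.
Fact pure_mulDr (x1 : M) (y1 y2 : N) :
  (x * x1) (x) (y * (y1 + y2)) = (x * x1) (x) (y * y1) + (x * x1) (x) (y * y2).
Proof. by rewrite mulrDr; exact: tensorDr. Qed.
Fact pure_mulZ (c : C) (x1 : M) (y1 : N) :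
  (x * (c *: x1 : M)) (x) (y * y1) = (x * x1) (x) (y * (c *: y1 : N)).
Proof.
rewrite (_ : x * (c *: x1 : M) = f c * (x * x1)); last exact: mulrCA.
rewrite (_ : y * (c *: y1 : N) = g c * (y * y1)); last exact: mulrCA.
exact: tensor_alg_balance.
Qed.
Definition pure_mul : T -> T :=
  tens_lift (@Balanced _ M N T (fun x1 y1 => (x * x1) (x) (y * y1))
    pure_mulDl pure_mulDr pure_mulZ).

Lemma pure_mul_tensor x1 y1 : pure_mul (x1 (x) y1) = (x * x1) (x) (y * y1).
Proof. exact: tens_lift_tensor. Qed.
Lemma pure_mulD : {morph pure_mul : t u / t + u}.
Proof. exact: tens_liftD. Qed.
End PureMul.

Section Mul.
Variable u : T.
Fact mul_balancedDl (x1 x2 : M) (y : N) :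
  pure_mul (x1 + x2) y u = pure_mul x1 y u + pure_mul x2 y u.
Proof.
move: u; apply: tens_ext => [a b|a b|x' y'].
- by rewrite pure_mulD.
- by rewrite !pure_mulD; exact: addrACA.
- by rewrite !pure_mul_tensor mulrDl; exact: tensorDl.
Qed.
Fact mul_balancedDr (x : M) (y1 y2 : N) :
  pure_mul x (y1 + y2) u = pure_mul x y1 u + pure_mul x y2 u.
Proof.
move: u; apply: tens_ext => [a b|a b|x' y'].
- by rewrite pure_mulD.
- by rewrite !pure_mulD; exact: addrACA.
- by rewrite !pure_mul_tensor mulrDl; exact: tensorDr.
Qed.
Fact mul_balancedZ (c : C) (x : M) (y : N) :
  pure_mul (c *: x : M) y u = pure_mul x (c *: y : N) u.
Proof.
move: u; apply: tens_ext; try exact: pure_mulD.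
move=> x' y'; rewrite !pure_mul_tensor.
rewrite (_ : (c *: x : M) * x' = f c * (x * x')); last exact/esym/mulrA.
rewrite (_ : (c *: y : N) * y' = g c * (y * y')); last exact/esym/mulrA.
exact: tensor_alg_balance.
Qed.
Definition tens_mulr : T -> T :=
  tens_lift (@Balanced _ M N T (fun x y => pure_mul x y u)
    mul_balancedDl mul_balancedDr mul_balancedZ).
End Mul.

Definition tens_mul (t u : T) : T := tens_mulr u t.

Lemma tens_mul_tensor x y x' y' :
  tens_mul (x (x) y) (x' (x) y') = (x * x') (x) (y * y').
Proof. by rewrite /tens_mul /tens_mulr tens_lift_tensor /= pure_mul_tensor. Qed.
Lemma tens_mulDl : left_distributive tens_mul +%R.
Proof. by move=> t t' u; exact: tens_liftD. Qed.
Lemma tens_mulDr : right_distributive tens_mul +%R.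
Proof.
move=> + t u; apply: tens_ext => [a b|a b|x y].
- by rewrite tens_mulDl.
- by rewrite !tens_mulDl; exact: addrACA.
- by rewrite /tens_mul /tens_mulr !tens_lift_tensor /= pure_mulD.
Qed.
Lemma tens_mulC : commutative tens_mul.
Proof.
move=> t u; move: t; apply: tens_ext => [a b|a b|x y].
- by rewrite tens_mulDl.
- by rewrite tens_mulDr.
move: u; apply: tens_ext => [a b|a b|x' y'].
- by rewrite tens_mulDr.
- by rewrite tens_mulDl.
by rewrite !tens_mul_tensor mulrC [y * _]mulrC.
Qed.
Lemma tens_mulA : associative tens_mul.
Proof.
move=> t u v; move: t; apply: tens_ext => [a b|a b|x y]; rewrite ?tens_mulDl //.
move: u; apply: tens_ext => [a b|a b|x1 y1]; rewrite ?(tens_mulDl, tens_mulDr) //.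
move: v; apply: tens_ext => [a b|a b|x2 y2]; rewrite ?tens_mulDr //.
by rewrite !tens_mul_tensor !mulrA.
Qed.
Lemma tens_mul1 : left_id (1 (x) 1) tens_mul.
Proof.
apply: tens_ext => [a b|//|x y]; first by rewrite tens_mulDr.
by rewrite tens_mul_tensor !mul1r.
Qed.

(** The zero ring is not an algebra here, hence the proof argument. *)
Definition tens_alg of 1 (x) 1 != 0 :> T : Type := T.

Variable nz : 1 (x) 1 != 0 :> T.
Local Notation TA := (tens_alg nz).

HB.instance Definition _ := GRing.Zmodule.copy TA T.
HB.instance Definition _ := GRing.Zmodule_isComNzRing.Build TA
  tens_mulA tens_mulC tens_mul1 tens_mulDl nz.

Definition tens_inl (x : X) : TA := x (x) 1.
Definition tens_inr (y : Y) : TA := 1 (x) y.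

Fact tens_inlD : {morph tens_inl : a b / a + b}.
Proof. by move=> a b; exact: tensorDl. Qed.
Fact tens_inlM : {morph tens_inl : a b / a * b}.
Proof.
by move=> a b; rewrite /tens_inl -[in LHS](mulr1 1); exact/esym/tens_mul_tensor.
Qed.
Fact tens_inrD : {morph tens_inr : a b / a + b}.
Proof. by move=> a b; exact: tensorDr. Qed.
Fact tens_inrM : {morph tens_inr : a b / a * b}.
Proof.
by move=> a b; rewrite /tens_inr -[in LHS](mulr1 1); exact/esym/tens_mul_tensor.
Qed.

Lemma tensorE x y : x (x) y = tens_inl x * tens_inr y.
Proof. by rewrite -[x in LHS]mulr1 -[y in LHS]mul1r; exact/esym/tens_mul_tensor. Qed.

Definition tens_alg_scale (a : k) (t : TA) : TA := tens_inl a%:A * t.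
Fact tens_alg_scaleA a b t :
  tens_alg_scale a (tens_alg_scale b t) = tens_alg_scale (a * b) t.
Proof.
by rewrite /tens_alg_scale mulrA -tens_inlM -scalerAl mul1r scalerA.
Qed.
Fact tens_alg_scale1 : left_id 1 tens_alg_scale.
Proof. by move=> t; rewrite /tens_alg_scale scale1r; exact: mul1r. Qed.
Fact tens_alg_scaleDr : right_distributive tens_alg_scale +%R.
Proof. by move=> a t u; exact: mulrDr. Qed.
Fact tens_alg_scaleDl t : {morph tens_alg_scale^~ t : a b / a + b}.
Proof. by move=> a b; rewrite /tens_alg_scale scalerDl tens_inlD mulrDl. Qed.
HB.instance Definition _ := GRing.Zmodule_isLmodule.Build k TA
  tens_alg_scaleA tens_alg_scale1 tens_alg_scaleDr tens_alg_scaleDl.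
Fact tens_alg_scaleAl (a : k) (t u : TA) : a *: (t * u) = (a *: t) * u.
Proof. exact: mulrA. Qed.
HB.instance Definition _ := GRing.Lmodule_isLalgebra.Build k TA tens_alg_scaleAl.
HB.instance Definition _ := GRing.Lalgebra_isComAlgebra.Build k TA.

Fact tens_inl1 : tens_inl 1 = 1. Proof. by []. Qed.
Fact tens_inlZ a x : tens_inl (a *: x) = a *: tens_inl x.
Proof. by rewrite -[x in LHS]mul1r scalerAl tens_inlM. Qed.
Fact tens_inr1 : tens_inr 1 = 1. Proof. by []. Qed.

Lemma tens_inlr c : tens_inl (f c) = tens_inr (g c).
Proof.
by rewrite /tens_inl -[f c]mulr1 tensor_alg_balance mulr1.
Qed.

Fact tens_inrZ a y : tens_inr (a *: y) = a *: tens_inr y.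
Proof.
have aE (B : comAlgType k) (h : {lrmorphism C -> B}) : h a%:A = a%:A.
  by rewrite linearZZ rmorph1.
by rewrite -[y in LHS]mul1r scalerAl tens_inrM -(aE _ g) -tens_inlr aE.
Qed.

HB.instance Definition _ := GRing.isLinear.Build k X TA *:%R tens_inl
  (fun a x y => etrans (tens_inlD (a *: x) y) (congr1 (+%R^~ _) (tens_inlZ a x))).
HB.instance Definition _ := GRing.isMonoidMorphism.Build X TA tens_inl
  (tens_inl1, tens_inlM).
HB.instance Definition _ := GRing.isLinear.Build k Y TA *:%R tens_inr
  (fun a x y => etrans (tens_inrD (a *: x) y) (congr1 (+%R^~ _) (tens_inrZ a x))).
HB.instance Definition _ := GRing.isMonoidMorphism.Build Y TA tens_inr
  (tens_inr1, tens_inrM).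

Lemma tens_alg_ind (P : TA -> Prop) :
  (forall x y, P (tens_inl x * tens_inr y)) -> P 0 ->
  (forall t u, P t -> P u -> P (t + u)) -> forall t, P t.
Proof.
move=> Pt P0 PD; apply: tens_ind => // x y.
by have -> : tensor x y = x (x) y by []; rewrite tensorE.
Qed.

(** [tens_alg] is the pushout of [f] and [g] in commutative algebras. *)
Lemma tens_alg_lift (D : comAlgType k) (u : {lrmorphism X -> D})
    (v : {lrmorphism Y -> D}) : u \o f =1 v \o g ->
  exists h : {lrmorphism TA -> D},
    (forall x, h (tens_inl x) = u x) /\ (forall y, h (tens_inr y) = v y).
Proof.
move=> uv.
have bDl (x1 x2 : M) (y : N) : u (x1 + x2) * v y = u x1 * v y + u x2 * v y.
  by rewrite raddfD mulrDl.
have bDr (x : M) (y1 y2 : N) : u x * v (y1 + y2) = u x * v y1 + u x * v y2.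
  by rewrite raddfD mulrDr.
have bZ (c : C) (x : M) (y : N) : u (c *: x : M) * v y = u x * v (c *: y : N).
  rewrite (rmorphM u (f c) x) (rmorphM v (g c) y) mulrCA mulrA.
  by have /= -> := uv c.
pose h0 : TA -> D := tens_lift (Balanced bDl bDr bZ).
have h0t x y : h0 (tens_inl x * tens_inr y) = u x * v y.
  by rewrite -tensorE; exact: tens_lift_tensor.
have h0D : {morph h0 : t t' / t + t'} by exact: tens_liftD.
have h00 : h0 0 = 0 by exact: additive0.
have h0M : {morph h0 : t t' / t * t'}.
  move=> + t'; apply: tens_alg_ind => [x y||t1 t2 e1 e2].
  - move: t'; apply: tens_alg_ind => [x' y'||t1 t2 e1 e2].
    + by rewrite mulrACA -tens_inlM -tens_inrM !h0t !rmorphM mulrACA.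
    + by rewrite !(mulr0, h00).
    + by rewrite !(mulrDr, h0D) e1 e2.
  - by rewrite !(mul0r, h00).
  - by rewrite !(mulrDl, h0D) e1 e2.
have h0l x : h0 (tens_inl x) = u x.
  by rewrite -[tens_inl x]mulr1 -tens_inr1 h0t rmorph1 mulr1.
have h0r y : h0 (tens_inr y) = v y.
  by rewrite -[tens_inr y]mul1r -tens_inl1 h0t rmorph1 mul1r.
have [|a t|h hE] := lrmorphism_exists h0D h0M; first by rewrite -tens_inl1 h0l rmorph1.
  have -> : a *: t = tens_inl a%:A * t by [].
  by rewrite h0M h0l linearZZ rmorph1 -scalerAl mul1r.
by exists h; split=> ?; rewrite hE.
Qed.

End TensorAlgebra.

(** * Faithfully flat descent *)

Section QuotientModule.
Variables (R : nzRingType) (M : lmodType R) (P : set M).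
Hypothesis P0 : P 0.
Hypothesis PP : forall a u v, P u -> P v -> P (a *: u + v).

Let PZ a u : P u -> P (a *: u).
Proof. by move=> Pu; rewrite -[_ *: _]addr0; exact: PP. Qed.
Let PD u v : P u -> P v -> P (u + v).
Proof. by move=> Pu Pv; rewrite -[u]scale1r; exact: PP. Qed.

Definition quot_rel (x y : M) : bool := `[< P (x - y) >].

Fact quot_rel_equiv : equiv_class_of quot_rel.
Proof.
split=> [x|x y|y x z]; first by apply/asboolP; rewrite subrr.
  by apply/asboolP/asboolP => /(PZ (-1)); rewrite scaleN1r opprB.
move=> /asboolP h1 /asboolP h2; apply/asboolP.
by rewrite -(subrK y x) -addrA; exact: PD.
Qed.
Canonical quot_equiv := EquivRelPack quot_rel_equiv.

Definition quot_mod : Type := {eq_quot quot_equiv}.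
HB.instance Definition _ := Choice.on quot_mod.
HB.instance Definition _ := EqQuotient.on quot_mod.

Definition quot_pi (x : M) : quot_mod := \pi_quot_mod x.

Lemma quot_piE x y : quot_pi x = quot_pi y <-> P (x - y).
Proof.
split=> [/eqP|h]; first by rewrite piE => /asboolP.
by apply/eqP; rewrite piE; apply/asboolP.
Qed.
Lemma quot_reprK (q : quot_mod) : quot_pi (repr q) = q.
Proof. exact: reprK. Qed.
Lemma quot_piK x : P (repr (quot_pi x) - x).
Proof. by apply/quot_piE; rewrite quot_reprK. Qed.

Definition quot_add (p q : quot_mod) : quot_mod := quot_pi (repr p + repr q).
Definition quot_opp (p : quot_mod) : quot_mod := quot_pi (- repr p).
Definition quot_scale (a : R) (p : quot_mod) : quot_mod := quot_pi (a *: repr p).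

Lemma quot_piD x y : quot_pi (x + y) = quot_add (quot_pi x) (quot_pi y).
Proof.
apply/esym/quot_piE; rewrite opprD addrACA; apply: PD; exact: quot_piK.
Qed.
Lemma quot_piN x : quot_pi (- x) = quot_opp (quot_pi x).
Proof.
apply/esym/quot_piE; rewrite -opprD -[- (_ - x)]scaleN1r; apply: PZ.
exact: quot_piK.
Qed.
Lemma quot_piZ a x : quot_pi (a *: x) = quot_scale a (quot_pi x).
Proof. by apply/esym/quot_piE; rewrite -scalerBr; apply: PZ; exact: quot_piK. Qed.

Fact quot_addA : associative quot_add.
Proof.
move=> x y z; rewrite -(quot_reprK x) -(quot_reprK y) -(quot_reprK z).
by rewrite -!quot_piD addrA.
Qed.
Fact quot_addC : commutative quot_add.
Proof. by move=> x y; rewrite /quot_add addrC. Qed.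
Fact quot_add0 : left_id (quot_pi 0) quot_add.
Proof. by move=> x; rewrite -(quot_reprK x) -quot_piD add0r. Qed.
Fact quot_addN : left_inverse (quot_pi 0) quot_opp quot_add.
Proof. by move=> x; rewrite -(quot_reprK x) -quot_piN -quot_piD addNr. Qed.
HB.instance Definition _ := GRing.isZmodule.Build quot_mod
  quot_addA quot_addC quot_add0 quot_addN.

Fact quot_scaleA a b q : quot_scale a (quot_scale b q) = quot_scale (a * b) q.
Proof. by rewrite -(quot_reprK q) -!quot_piZ scalerA. Qed.
Fact quot_scale1 : left_id 1 quot_scale.
Proof. by move=> q; rewrite -(quot_reprK q) -quot_piZ scale1r. Qed.
Fact quot_scaleDr : right_distributive quot_scale +%R.
Proof.
move=> a p q; rewrite -(quot_reprK p) -(quot_reprK q).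
by rewrite -[X in quot_scale a X]quot_piD -!quot_piZ scalerDr quot_piD.
Qed.
Fact quot_scaleDl q : {morph quot_scale^~ q : a b / a + b}.
Proof.
by move=> a b; rewrite -(quot_reprK q) -!quot_piZ scalerDl quot_piD.
Qed.
HB.instance Definition _ := GRing.Zmodule_isLmodule.Build R quot_mod
  quot_scaleA quot_scale1 quot_scaleDr quot_scaleDl.

Lemma quotient_module : exists (Q : lmodType R) (p : {linear M -> Q}),
  (forall q, exists m, p m = q) /\ (forall m, p m = 0 <-> P m).
Proof.
have lin_pi : linear quot_pi by move=> a x y; rewrite quot_piD quot_piZ.
have [p pE] := linear_exists lin_pi.
exists quot_mod, p; split=> [q|m]; first by exists (repr q); rewrite pE quot_reprK.
rewrite pE; have -> : (0 : quot_mod) = quot_pi 0 by [].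
by rewrite quot_piE subr0.
Qed.
End QuotientModule.

(** Flatness speaks of injective maps between modules; this turns the image of a
    map into a module of its own. *)
Lemma image_factorization (R : nzRingType) (M N : lmodType R) (h : {linear M -> N}) :
  exists (Q : lmodType R) (p : {linear M -> Q}) (i : {linear Q -> N}),
    [/\ forall q, exists m, p m = q, injective i & forall m, i (p m) = h m].
Proof.
have [||Q [p [p_surj pE]]] := @quotient_module R M [set m | h m = 0].
- exact: raddf0.
- by move=> a u v /= hu hv; rewrite linearP hu hv scaler0 addr0.
have [s sK] := choice p_surj.
have hs m : h (s (p m)) = h m.
  apply/eqP; rewrite -subr_eq0 -raddfB; apply/eqP.
  by apply/pE; rewrite linearB sK subrr.
have lin_hs : linear (h \o s).
  move=> a x y /=; rewrite -linearP -(sK x) -(sK y).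
  by rewrite -[a *: p _ + _]linearP !hs !sK linearP.
have [i iE] := linear_exists lin_hs.
exists Q, p, i; split=> // [x y|m]; rewrite !iE /= ?hs //.
move=> /eqP; rewrite -subr_eq0 -raddfB => /eqP/pE.
by rewrite linearB !sK => /eqP; rewrite subr_eq0 => /eqP.
Qed.

Section FaithfullyFlat.
Variables (C A : comNzRingType) (f : {rmorphism C -> A}).
Hypothesis ff : faithfully_flat f.
Local Notation fA := (res_mod f A^o).

(** If [q (x) 1 = 0] then the cyclic submodule generated by [q] dies after
    tensoring with [A], hence was zero already. *)
Lemma faithfully_flat_unit_inj (Q : lmodType C) (q : Q) :
  tensor q (1 : fA) = 0 -> q = 0.
Proof.
case: ff => flat_f faith q1.
have [h hE] : exists h : {linear C^o -> Q}, forall c, h c = c *: q.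
  have lin : linear (fun c : C^o => c *: q).
    by move=> a u v; rewrite scalerDl scalerA.
  by have [h hE] := linear_exists lin; exists h.
have [N [p [i [p_surj i_inj ipE]]]] := image_factorization h.
suff p10 : p 1 = 0 by rewrite -[q]scale1r -hE -ipE p10 raddf0.
apply: faith.
have pt1 : tensor (p 1) (1 : fA) = 0.
  apply: (flat_f _ _ _ i_inj); rewrite tens_map0 tens_map_tensor /= ipE hE.
  by rewrite scale1r.
have pt a : tensor (p 1) (a : fA) = 0.
  have lin : linear (fun x : fA => a * (x : A) : fA).
    by move=> c u v; rewrite mulrDr; congr (_ + _); exact: mulrCA.
  have [m mE] := linear_exists lin.
  have := congr1 (tens_map (idfun : {linear N -> N}) m) pt1.
  by rewrite tens_map0 tens_map_tensor /= mE mulr1.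
apply: tens_ind => [n a||x y -> ->] //; last by rewrite addr0.
have [c <-] := p_surj n.
have -> : p c = c *: p 1 by rewrite -linearZZ; congr (p _); exact/esym/mulr1.
by rewrite tensorZ pt.
Qed.

Lemma faithfully_flat_inj : injective f.
Proof.
move=> x y exy; apply/eqP; rewrite -subr_eq0; apply/eqP.
have f0 : f (x - y) = 0 by rewrite rmorphB exy subrr.
apply: (@faithfully_flat_unit_inj C^o (x - y)).
have -> : x - y = (x - y) *: (1 : C^o) by exact/esym/mulr1.
rewrite tensorZ (_ : _ *: (1 : fA) = 0); first by rewrite tensorr0.
by rewrite -f0; exact: mulr1.
Qed.

(** The class of [a] modulo [f(C)] is killed by [- (x) 1] because
    [a (x) 1 = 1 (x) a] and the class of [1] is zero. *)
Lemma faithfully_flat_image (a : A) :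
  tensor (a : fA) (1 : fA) = tensor (1 : fA) (a : fA) -> exists c, f c = a.
Proof.
move=> a11a.
have [||Q [p [_ pE]]] := @quotient_module C fA [set x | exists c, f c = x].
- by exists 0; rewrite rmorph0.
- by move=> b _ _ [c <-] [d <-]; exists (b * c + d); rewrite rmorphD rmorphM.
apply/pE/faithfully_flat_unit_inj.
have := congr1 (tens_map p (idfun : {linear fA -> fA})) a11a.
rewrite !tens_map_tensor /= => ->.
by rewrite (_ : p 1 = 0) ?tensor0l //; apply/pE; exists 1; rewrite rmorph1.
Qed.
End FaithfullyFlat.

Section Descent.
Variable k : fieldType.

(** A faithfully flat algebra has no empty fibre: base change along [g] keeps it
    nonzero. *)
Lemma faithfully_flat_nz (C X A : comAlgType k) (g : {lrmorphism C -> X})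
    (f : {lrmorphism C -> A}) : faithfully_flat f ->
  tensor (1 : res_mod (g : {rmorphism C -> X}) X^o)
    (1 : res_mod (f : {rmorphism C -> A}) A^o) != 0.
Proof.
move=> ff; apply/eqP => /(faithfully_flat_unit_inj ff) /eqP.
by have := oner_neq0 X => /negbTE; rewrite /GRing.one /= => ->.
Qed.

(** [f] is the equalizer of all the pairs of maps that it equalizes. *)
Definition regular_mono (C A : comAlgType k) (f : {lrmorphism C -> A}) : Prop :=
  injective f /\
  forall a, (forall (D : comAlgType k) (i j : {lrmorphism A -> D}),
    i \o f =1 j \o f -> i a = j a) -> exists c, f c = a.

Lemma faithfully_flat_regular_mono (C A : comAlgType k) (f : {lrmorphism C -> A}) :
  faithfully_flat f -> regular_mono f.
Proof.
move=> ff; split=> [|a ija]; first exact: faithfully_flat_inj ff.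
apply: (faithfully_flat_image ff).
pose nz := faithfully_flat_nz f ff.
apply: (ija (tens_alg nz) (tens_inl nz) (tens_inr nz)) => c.
exact: tens_inlr.
Qed.

Lemma base_functional (X : comAlgType k) :
  exists r : {linear X -> k^o}, r 1 = 1.
Proof.
have inj : injective (@struct_map k X).
  exact: (fmorph_inj (in_alg X : {rmorphism k -> X})).
have [r rK] := linear_retraction inj.
by exists r; rewrite -[RHS]rK; congr (r _); exact/esym/(rmorph1 (@struct_map k X)).
Qed.

Lemma struct_mapE (X : comAlgType k) (a : k) : struct_map X a = a%:A.
Proof. by []. Qed.

Lemma lrmorph_struct (X D : comAlgType k) (u : {lrmorphism X -> D}) (a : k) :
  u (struct_map X a) = struct_map D a.
Proof. by rewrite !struct_mapE linearZZ rmorph1. Qed.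

Section Contraction.
Variables X Y : comAlgType k.
Local Notation M := (res_mod (@struct_map k X : {rmorphism k^o -> X}) X^o).
Local Notation N := (res_mod (@struct_map k Y : {rmorphism k^o -> Y}) Y^o).

(** Evaluating a linear form on the second factor. *)
Lemma tens_contract (r : {linear Y -> k^o}) :
  exists h : tens M N -> X, {morph h : t u / t + u} /\
    forall (x : X) (y : Y), h (tensor (x : M) (y : N)) = (r y : k) *: x.
Proof.
have bDl (x x' : M) (y : N) :
  (r y : k) *: (x + x' : X) = (r y : k) *: (x : X) + (r y : k) *: (x' : X).
  exact: scalerDr.
have bDr (x : M) (y y' : N) :
  (r (y + y') : k) *: (x : X) = (r y : k) *: (x : X) + (r y' : k) *: (x : X).
  by rewrite raddfD scalerDl.
have bZ (c : k^o) (x : M) (y : N) :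
  (r y : k) *: ((c *: x : M) : X) = (r (c *: y : N) : k) *: (x : X).
  rewrite [c *: x](_ : _ = (c : k) *: (x : X)); last exact: mulr_algl.
  rewrite [c *: y](_ : _ = (c : k) *: (y : Y)); last exact: mulr_algl.
  rewrite scalerA mulrC; by congr (_ *: _); rewrite linearZZ.
pose b : balanced M N X :=
  @Balanced _ M N X (fun x y => (r y : k) *: (x : X)) bDl bDr bZ.
exists (tens_lift b); split=> [t u|x y]; first exact: tens_liftD.
exact: (tens_lift_tensor b).
Qed.

Lemma base_tensor_nz : tensor (1 : M) (1 : N) != 0.
Proof.
have [r r1] := base_functional Y; have [h [hD ht]] := tens_contract r.
apply/eqP => /(congr1 h); rewrite additive0 // ht r1 scale1r => /eqP.
by apply/negP; exact: oner_neq0.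
Qed.

Definition base_tensor : comAlgType k := tens_alg base_tensor_nz.
Definition base_inl : {lrmorphism X -> base_tensor} := tens_inl base_tensor_nz.
Definition base_inr : {lrmorphism Y -> base_tensor} := tens_inr base_tensor_nz.

Lemma base_tensor_ind (P : base_tensor -> Prop) :
  (forall x y, P (base_inl x * base_inr y)) -> P 0 ->
  (forall t u, P t -> P u -> P (t + u)) -> forall t, P t.
Proof. exact: tens_alg_ind. Qed.

Lemma base_tensor_lift (D : comAlgType k) (u : {lrmorphism X -> D})
    (v : {lrmorphism Y -> D}) : exists h : {lrmorphism base_tensor -> D},
  h \o base_inl =1 u /\ h \o base_inr =1 v.
Proof.
have [a|h [hl hr]] := @tens_alg_lift k _ X Y _ _ base_tensor_nz D u v.
  by rewrite /= !lrmorph_struct.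
by exists h.
Qed.

Lemma base_tensor_contract (r : {linear Y -> k^o}) :
  exists h : {linear base_tensor -> X},
    forall x y, h (base_inl x * base_inr y) = (r y : k) *: x.
Proof.
have [h [hD ht]] := tens_contract r.
have hxy x y : h (base_inl x * base_inr y) = (r y : k) *: x.
  by rewrite -ht; congr h; exact/esym/tensorE.
have hZ (a : k) (t : base_tensor) : h (a *: t) = a *: h t.
  move: t; apply: base_tensor_ind => [x y||t u et eu].
  - by rewrite scalerAl -linearZZ !hxy !scalerA mulrC.
  - by rewrite scaler0 additive0 // scaler0.
  - by rewrite scalerDr !hD et eu scalerDr.
have lin_h : linear (h : base_tensor -> X) by move=> a t u; rewrite hD hZ.
have [h' hE] := linear_exists lin_h.
by exists h' => x y; rewrite hE hxy.
Qed.
End Contraction.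

Lemma struct_map_regular_mono (X : comAlgType k) :
  regular_mono (@struct_map k X : {lrmorphism k^o -> X}).
Proof.
split=> [|a ija]; first exact: (fmorph_inj (in_alg X : {rmorphism k -> X})).
have [r r1] := base_functional X; have [h hE] := base_tensor_contract X r.
exists (r a).
have hl : h (base_inl X X a) = a.
  by rewrite -[base_inl X X a]mulr1 -(rmorph1 (base_inr X X)) hE r1 scale1r.
have hr : h (base_inr X X a) = (r a : k)%:A.
  by rewrite -[base_inr X X a]mul1r -(rmorph1 (base_inl X X)) hE.
rewrite -[RHS]hl (ija _ (base_inl X X) (base_inr X X)) ?hr // => c.
by rewrite /= !lrmorph_struct.
Qed.

Variable G : group_functor k.

Lemma eq_points_map (B C : comAlgType k) (f g : {lrmorphism B -> C}) (x : G B) :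
  f =1 g -> points_map G f x = points_map G g x.
Proof. by move=> /lrmorphism_eq ->. Qed.

Lemma points_mapA (B C D E : comAlgType k) (f : {lrmorphism B -> C})
    (g : {lrmorphism C -> D}) (f' : {lrmorphism B -> E})
    (g' : {lrmorphism E -> D}) (x : G B) : g \o f =1 g' \o f' ->
  points_map G g (points_map G f x) = points_map G g' (points_map G f' x).
Proof. by move=> e; rewrite -!points_map_comp; exact: eq_points_map. Qed.

Section Representable.
Variables (A0 : comAlgType k) (u : G A0).
Hypothesis Gu : represents u.

Lemma points_map_inj (C A : comAlgType k) (f : {lrmorphism C -> A}) :
  injective f -> injective (points_map G f).
Proof.
move=> inj_f x y exy; have [g [gx _]] := Gu x; have [h [hy _]] := Gu y.
have [m [_ m_uniq]] := Gu (points_map G f x).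
have efg : f \o g =1 m by apply: m_uniq; rewrite points_map_comp gx.
have efh : f \o h =1 m by apply: m_uniq; rewrite points_map_comp hy exy.
rewrite -gx -hy; apply: eq_points_map => a.
by apply: inj_f; rewrite [LHS]efg [RHS]efh.
Qed.

(** A representable functor turns an equalizer of algebras into an equalizer
    of sets of points. *)
Lemma points_descent (C A : comAlgType k) (f : {lrmorphism C -> A}) (x : G A) :
  regular_mono f ->
  (forall (D : comAlgType k) (i j : {lrmorphism A -> D}),
    i \o f =1 j \o f -> points_map G i x = points_map G j x) ->
  exists y, points_map G f y = x.
Proof.
move=> [inj_f im_f] ijx; have [h [hx _]] := Gu x.
have /choice[s sE] a : exists c, f c = h a.
  apply: im_f => D i j ij; have [m [_ m_uniq]] := Gu (points_map G i x).
  have ei : i \o h =1 m by apply: m_uniq; rewrite points_map_comp hx.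
  have ej : j \o h =1 m.
    by apply: m_uniq; rewrite points_map_comp hx (ijx _ _ _ ij).
  by rewrite [LHS]ei [RHS]ej.
have [||||g gE] := @lrmorphism_exists k A0 C s.
- by move=> a b; apply: inj_f; rewrite rmorphD /= !sE rmorphD.
- by move=> a b; apply: inj_f; rewrite rmorphM /= !sE rmorphM.
- by apply: inj_f; rewrite sE !rmorph1.
- by move=> a b; apply: inj_f; rewrite linearZZ /= !sE linearZZ.
exists (points_map G g u); rewrite -hx -points_map_comp.
by apply: eq_points_map => a /=; rewrite gE.
Qed.
End Representable.
End Descent.

(** * Crossed homomorphisms *)

(** Vector spaces are flat, because an injection has a retraction. *)
Lemma tens_map_inj (k : fieldType) (V W N : lmodType k) (i : {linear V -> W}) :
  injective i -> injective (tens_map (N := N) i (idfun : {linear N -> N})).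
Proof.
move=> /linear_retraction[r rK].
have K : cancel (tens_map i (idfun : {linear N -> N})) (tens_map r idfun).
  apply: tens_ext => [x y|x y|v n]; rewrite ?tens_mapD //.
  by rewrite !tens_map_tensor rK.
exact: can_inj K.
Qed.

Lemma tens_map_eq0 (R : comNzRingType) (M M' N N' : lmodType R)
    (f : {linear M -> M'}) (g : {linear N -> N'}) x :
  (forall m, f m = 0) -> tens_map f g x = 0.
Proof.
move=> f0; move: x; apply: tens_ind => [m n||x y ex ey].
- by rewrite tens_map_tensor f0 tensor0l.
- exact: tens_map0.
- by rewrite tens_mapD ex ey addr0.
Qed.

Lemma addBKA (W : zmodType) (a b d : W) : a + (b - a + d) = b + d.
Proof. by rewrite addrA [a + _]addrC subrK. Qed.

Section CrossedHom.
Variables (k : fieldType) (H : group_functor k) (V : representation H).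

Definition crossed_hom (c : forall B : comAlgType k, H B -> tens V B) : Prop :=
  (forall (B : comAlgType k) (g h : H B),
    c B (g * h)%g = c B g + rep_act V g (c B h)) /\
  (forall (B D : comAlgType k) (f : {lrmorphism B -> D}) (g : H B),
    c D (points_map H f g) =
      tens_map (idfun : {linear V -> V}) (f : {linear B -> D}) (c B g)).

Variable c : forall B : comAlgType k, H B -> tens V B.
Hypothesis cP : crossed_hom c.

Local Notation bscale b :=
  (tens_map idfun (b \*o idfun : {linear _ -> _})).

Lemma bscaleD (W : lmodType k) (B : comAlgType k) (a b : B) (x : tens W B) :
  bscale (a + b) x = bscale a x + bscale b x.
Proof.
move: x; apply: tens_ext => [x y|x y|w d]; rewrite ?tens_mapD //.
  exact: addrACA.
by rewrite !tens_map_tensor /= mulrDl tensorDr.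
Qed.

Lemma bscaleM (W : lmodType k) (B : comAlgType k) (a b : B) (x : tens W B) :
  bscale (a * b) x = bscale a (bscale b x).
Proof.
move: x; apply: tens_ext => [x y|x y|w d]; rewrite ?tens_mapD //.
by rewrite !tens_map_tensor /= mulrA.
Qed.

Lemma bscale1 (W : lmodType k) (B : comAlgType k) (x : tens W B) :
  bscale (1 : B) x = x.
Proof.
move: x; apply: tens_ext => [x y|//|w d]; rewrite ?tens_mapD //.
by rewrite !tens_map_tensor /= mul1r.
Qed.

Lemma bscale_map (W W' : lmodType k) (i : {linear W -> W'}) (B : comAlgType k)
    (b : B) (x : tens W B) :
  tens_map i (idfun : {linear B -> B}) (bscale b x) =
  bscale b (tens_map i (idfun : {linear B -> B}) x).
Proof. by rewrite -!tens_map_comp; exact: eq_tens_map. Qed.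

Lemma bscale_natural (W : lmodType k) (B D : comAlgType k)
    (f : {lrmorphism B -> D}) (b : B) (x : tens W B) :
  tens_map (idfun : {linear W -> W}) (f : {linear B -> D}) (bscale b x) =
  bscale (f b) (tens_map (idfun : {linear W -> W}) (f : {linear B -> D}) x).
Proof.
rewrite -!tens_map_comp; apply: eq_tens_map => // d; exact: rmorphM.
Qed.

Lemma tens_map_natural (W W' : lmodType k) (i : {linear W -> W'})
    (B D : lmodType k) (f : {linear B -> D}) (x : tens W B) :
  tens_map (idfun : {linear W' -> W'}) f (tens_map i (idfun : {linear B -> B}) x) =
  tens_map i (idfun : {linear D -> D}) (tens_map (idfun : {linear W -> W}) f x).
Proof. by rewrite -!tens_map_comp; exact: eq_tens_map. Qed.

Local Notation E := (V * k^o)%type.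

Let in1_lin : linear (fun v : V => (v, 0) : E).
Proof. by move=> a u v; congr (_, _); rewrite /= scaler0 addr0. Qed.
Definition ext_in : V -> E := fun v => (v, 0).
HB.instance Definition _ := GRing.isLinear.Build k V E *:%R ext_in in1_lin.
Definition ext_fst : E -> V := fst.
HB.instance Definition _ := GRing.Linear.copy ext_fst (@fst V k^o).

Section Points.
Variable B : comAlgType k.
Local Notation iV := (tens_map ext_in (idfun : {linear B -> B})).
Local Notation pV := (tens_map ext_fst (idfun : {linear B -> B})).

Fact ext_snd_balancedDl (e e' : E) (b : B) :
  (e + e').2 *: b = e.2 *: b + e'.2 *: b.
Proof. exact: scalerDl. Qed.
Fact ext_snd_balancedDr (e : E) (b b' : B) :
  e.2 *: (b + b') = e.2 *: b + e.2 *: b'.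
Proof. exact: scalerDr. Qed.
Fact ext_snd_balancedZ (a : k) (e : E) (b : B) :
  (a *: e).2 *: b = e.2 *: (a *: b).
Proof. by rewrite scalerA mulrC. Qed.
Definition ext_snd : tens E B -> B :=
  tens_lift (Balanced ext_snd_balancedDl ext_snd_balancedDr ext_snd_balancedZ).

Lemma ext_snd_tensor e b : ext_snd (tensor e b) = e.2 *: b.
Proof. exact: tens_lift_tensor. Qed.
Lemma ext_sndD : {morph ext_snd : x y / x + y}.
Proof. exact: tens_liftD. Qed.
Lemma ext_snd_in x : ext_snd (iV x) = 0.
Proof.
move: x; apply: tens_ind => [v b||x y ex ey].
- by rewrite tens_map_tensor ext_snd_tensor scale0r.
- by rewrite tens_map0 additive0 //; exact: ext_sndD.
- by rewrite tens_mapD ext_sndD ex ey addr0.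
Qed.
Lemma ext_fst_in x : pV (iV x) = x.
Proof.
rewrite -tens_map_comp -[RHS]tens_map_id; exact: eq_tens_map.
Qed.
Lemma ext_snd_scale b x : ext_snd (bscale b x) = b * ext_snd x.
Proof.
move: x; apply: tens_ext => [x y|x y|e d].
- by rewrite tens_mapD ext_sndD.
- by rewrite ext_sndD mulrDr.
- by rewrite tens_map_tensor !ext_snd_tensor /= scalerAr.
Qed.

(** The extension of the trivial representation by [V] with class [c]:
    [g (v, t) = (g v + t c(g), t)]. *)
Definition ext_act (g : H B) (x : tens E B) : tens E B :=
  x + iV (rep_act V g (pV x) - pV x + bscale (ext_snd x) (c g)).

Lemma ext_snd_act g x : ext_snd (ext_act g x) = ext_snd x.
Proof. by rewrite ext_sndD ext_snd_in addr0. Qed.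
Lemma ext_fst_act g x :
  pV (ext_act g x) = rep_act V g (pV x) + bscale (ext_snd x) (c g).
Proof. by rewrite tens_mapD ext_fst_in addBKA. Qed.

Lemma ext_actD g : {morph ext_act g : x y / x + y}.
Proof.
move=> x y; rewrite /ext_act addrACA -tens_mapD; congr (_ + tens_map _ _ _).
rewrite ext_sndD bscaleD tens_mapD raddfD opprD [RHS]addrACA; congr (_ + _).
exact: addrACA.
Qed.
Fact ext_act_zmod g : zmod_morphism (ext_act g).
Proof.
move=> x y; apply: (addIr (ext_act g y)).
by rewrite -ext_actD !subrK.
Qed.
HB.instance Definition _ g :=
  GRing.isZmodMorphism.Build _ _ (ext_act g) (ext_act_zmod g).

Lemma crossed_hom1 : c (1%g : H B) = 0.
Proof.
have [/(_ B 1%g 1%g) + _] := cP; rewrite mulg1 rep_act1 => cc.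
by apply: (addrI (c (1%g : H B))); rewrite addr0 -cc.
Qed.
Fact ext_act1 x : ext_act 1%g x = x.
Proof.
by rewrite /ext_act rep_act1 subrr crossed_hom1 tens_map0 addr0 tens_map0 addr0.
Qed.
Fact ext_actM g h x : ext_act (g * h)%g x = ext_act g (ext_act h x).
Proof.
have [cM _] := cP.
rewrite [RHS]/ext_act ext_snd_act ext_fst_act [ext_act h x]/ext_act -addrA.
rewrite -tens_mapD /ext_act; congr (_ + tens_map _ _ _).
rewrite rep_actM cM tens_mapD raddfD rep_act_scale.
set q := bscale _ (c h); set a := rep_act V h _.
rewrite [a - _ + q]addrAC [a + q - _]addrC -[RHS]addrA addBKA.
rewrite -[LHS]addrA [LHS]addrCA; congr (_ + _).
by rewrite -[RHS]addrA; congr (_ + _); exact: addrC.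
Qed.
Fact ext_act_scale g (b : B) x : ext_act g (bscale b x) = bscale b (ext_act g x).
Proof.
rewrite /ext_act [RHS]tens_mapD ext_snd_scale; congr (_ + _).
rewrite -bscale_map; congr (tens_map _ _ _).
by rewrite bscale_map rep_act_scale bscaleM -tens_mapB -tens_mapD.
Qed.
End Points.

Lemma ext_snd_natural (B D : comAlgType k) (f : {lrmorphism B -> D}) x :
  ext_snd (tens_map (idfun : {linear E -> E}) (f : {linear B -> D}) x) =
  f (ext_snd x).
Proof.
move: x; apply: tens_ext => [x y|x y|e d].
- by rewrite tens_mapD ext_sndD.
- by rewrite ext_sndD raddfD.
- by rewrite tens_map_tensor !ext_snd_tensor linearZZ.
Qed.

Fact ext_act_map (B D : comAlgType k) (f : {lrmorphism B -> D}) (g : H B) x :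
  tens_map (idfun : {linear E -> E}) (f : {linear B -> D}) (ext_act g x)
  = ext_act (points_map H f g)
        (tens_map (idfun : {linear E -> E}) (f : {linear B -> D}) x).
Proof.
have [_ cN] := cP.
rewrite /ext_act tens_mapD tens_map_natural; congr (_ + tens_map _ _ _).
rewrite tens_mapD tens_mapB rep_act_map bscale_natural tens_map_natural -cN.
by rewrite ext_snd_natural.
Qed.

Definition extension : representation H :=
  @Representation k H E (fun B g => @ext_act B g) ext_act_scale ext_act1 ext_actM
    ext_act_map.

Lemma ext_in_rep_hom : exists i : rep_hom V extension, i =1 ext_in.
Proof.
have act (B : comAlgType k) (g : H B) x :
  tens_map ext_in (idfun : {linear B -> B}) (rep_act V g x)
  = rep_act extension g (tens_map ext_in (idfun : {linear B -> B}) x).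
  rewrite /= /ext_act ext_fst_in ext_snd_in (_ : bscale _ _ = 0); last first.
    apply: (@additive0 _ _ (fun b : B => bscale b (c g))) => a b.
    exact: bscaleD.
  by rewrite addr0 [X in X + _]/= tens_mapB addrC subrK.
by exists (@RepHom k H V extension ext_in act).
Qed.

(** The map [V -> I_0] into an injective representation extends to the extension
    of [k] by [V], which makes [c] principal in [I_0]; the vanishing of [H^1]
    moves the witness into [V]. *)
Lemma crossed_hom_principal : cohomology_vanishes 1 V ->
  exists v : V, forall (B : comAlgType k) (g : H B),
    c g = rep_act V g (tensor v (1 : B)) - tensor v (1 : B).
Proof.
move=> [I H1]; have [i iE] := ext_in_rep_hom.
have [|phi phiE] := @res_injective _ _ _ I 0%N V extension i (res_aug I).
  by move=> v w; rewrite !iE => -[].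
pose e : E := (0, 1).
pose x : res_term I 0 := phi e.
have dphi v : res_d I 0 (phi (ext_in v)) = 0.
  by rewrite -iE phiE; apply/res_exact0; exists v.
have act_e (B : comAlgType k) (g : H B) :
  rep_act (res_term I 0) g (tensor x (1 : B)) =
  tensor x 1 + tens_map phi (idfun : {linear B -> B})
    (tens_map ext_in (idfun : {linear B -> B}) (c g)).
  have xE : tensor x (1 : B) = tens_map phi (idfun : {linear B -> B}) (tensor e (1 : B)).
    by rewrite tens_map_tensor.
  rewrite xE -rep_hom_act -tens_mapD; congr (tens_map _ _ _).
  rewrite /= /ext_act tens_map_tensor /= ext_snd_tensor scale1r bscale1.
  by rewrite tensor0l raddf0 subrr add0r.
have [|y [inv_y dy]] := H1 (res_d I 0 x).
  split; last by apply/res_exact; exists x.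
  move=> B g.
  have -> : tensor (res_d I 0 x) (1 : B) =
    tens_map (res_d I 0) (idfun : {linear B -> B}) (tensor x (1 : B)).
    by rewrite tens_map_tensor.
  rewrite -rep_hom_act act_e tens_mapD -!tens_map_comp.
  by rewrite [X in _ + X]tens_map_eq0 ?addr0.
have [v vE] : exists v, res_aug I v = x - y.
  by apply/res_exact0; rewrite linearB dy subrr.
exists v => B g.
(* The equation in [V (x) B] is checked in [I_0 (x) B]. *)
apply: (tens_map_inj (@res_aug_inj _ _ _ I)).
have tv : tens_map (res_aug I) (idfun : {linear B -> B}) (tensor v (1 : B)) =
  tensor x 1 - tensor y 1.
  rewrite tens_map_tensor vE; apply: (addIr (tensor y (1 : B))).
  by rewrite subrK -tensorDl subrK.
rewrite tens_mapB rep_hom_act tv raddfB act_e inv_y.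
rewrite opprB addrA subrK addrC addKr -tens_map_comp.
by apply: eq_tens_map => // w; rewrite /= -iE phiE.
Qed.
End CrossedHom.

(** * Lifting rational points *)

Lemma mult1 (X Y : groupType) (f : {multiplicative X -> Y}) : f 1%g = 1%g.
Proof. by apply: (mulgI (f 1%g)); rewrite -gmulfM !mulg1. Qed.

Lemma multV (X Y : groupType) (f : {multiplicative X -> Y}) x :
  f (x^-1)%g = (f x)^-1%g.
Proof. by apply: (mulgI (f x)); rewrite -gmulfM !mulgV mult1. Qed.

(** A point [z : Spec B -> Q] lifts over the pullback of [G] along [z]. *)
Lemma faithfully_flat_hom_lift (k : fieldType) (G Q : group_functor k)
    (q : group_hom G Q) (B : comAlgType k) (z : Q B) : faithfully_flat_hom q ->
  exists (D : comAlgType k) (f : {lrmorphism B -> D}) (x : G D),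
    q D x = points_map Q f z.
Proof.
move=> [A [u [C [w [f [Gu Qw wu ff]]]]]]; have [g [gw _]] := Qw B z.
pose nz := faithfully_flat_nz g ff.
exists (tens_alg nz), (tens_inl nz), (points_map G (tens_inr nz) u).
rewrite group_hom_natural -wu -gw.
by apply: points_mapA => c; rewrite /= tens_inlr.
Qed.

Section VectorQuotient.
Variables (k : fieldType) (G : group_functor k).

(** [H / N] identified with the vector group of [V]; the projection is extended
    to a total function on [G] with junk values outside [H]. *)
Record vector_quotient (H N : subgroup G) (V : lmodType k) := VectorQuotient {
  vq_map :> forall B : comAlgType k, G B -> tens V B;
  vqM : forall (B : comAlgType k) (x y : G B), H B x -> H B y ->
    vq_map (x * y)%g = vq_map x + vq_map y;
  vq_ker : forall (B : comAlgType k) (x : G B), H B x -> vq_map x = 0 <-> N B x;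
  vq_natural : forall (B D : comAlgType k) (f : {lrmorphism B -> D}) (x : G B),
    H B x -> vq_map (points_map G f x) =
      tens_map (idfun : {linear V -> V}) (f : {linear B -> D}) (vq_map x);
  vq_lift : forall (B : comAlgType k) (y : tens V B),
    exists (D : comAlgType k) (f : {lrmorphism B -> D}) (x : G D), H D x /\
      vq_map x = tens_map (idfun : {linear V -> V}) (f : {linear B -> D}) y }.

Section Construction.
Variables (H N : subgroup G) (Q : group_functor k).
Variables (q : group_hom (sub_functor H) Q).
Variables (V : lmodType k) (phi : group_hom (vect_functor V) Q).
Hypothesis qP : is_quotient q (subgroup_in H N).
Hypothesis phi_iso : is_iso phi.

Definition vq_fun (B : comAlgType k) (x : G B) : tens V B :=
  xget 0 [set y : tens V B |
    forall hx : H B x, phi B (y : vect_functor V B) = q B (sub_elt hx)].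

Lemma vq_funE (B : comAlgType k) (x : G B) (hx : H B x) :
  phi B (vq_fun x : vect_functor V B) = q B (sub_elt hx).
Proof.
rewrite /vq_fun; case: xgetP => [y _ /= yE|no]; first exact: yE.
have [psi _ psiK] := phi_iso B.
case: (no (psi (q B (sub_elt hx)))) => hx' /=.
by rewrite psiK (Prop_irrelevance hx hx').
Qed.

Lemma phi_inj (B : comAlgType k) (x y : tens V B) :
  phi B (x : vect_functor V B) = phi B (y : vect_functor V B) -> x = y.
Proof. exact: (bij_inj (phi_iso B)). Qed.

Lemma phiD (B : comAlgType k) (x y : tens V B) :
  phi B ((x + y : tens V B) : vect_functor V B) =
  (phi B (x : vect_functor V B) * phi B (y : vect_functor V B))%g.
Proof. exact: (gmulfM (s := phi B) (x : vect_functor V B) (y : vect_functor V B)). Qed.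

Lemma phi0 (B : comAlgType k) : phi B ((0 : tens V B) : vect_functor V B) = 1%g.
Proof. exact: (mult1 (phi B)). Qed.

Lemma phi_natural (B D : comAlgType k) (f : {lrmorphism B -> D}) (x : tens V B) :
  phi D (tens_map (idfun : {linear V -> V}) (f : {linear B -> D}) x : vect_functor V D) =
  points_map Q f (phi B (x : vect_functor V B)).
Proof. exact: (group_hom_natural phi f (x : vect_functor V B)). Qed.

Lemma vector_quotient_exists : exists kap : vector_quotient H N V,
  forall (B : comAlgType k) (x : G B) (hx : H B x),
    phi B (kap B x : vect_functor V B) = q B (sub_elt hx).
Proof.
have fM (B : comAlgType k) (x y : G B) : H B x -> H B y ->
    vq_fun (x * y)%g = vq_fun x + vq_fun y.
  move=> hx hy; apply: phi_inj; rewrite phiD.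
  rewrite (vq_funE (subpointsM hx hy)) (vq_funE hx) (vq_funE hy) -gmulfM.
  by congr (q B _); exact: val_inj.
have fker (B : comAlgType k) (x : G B) : H B x -> vq_fun x = 0 <-> N B x.
  move=> hx; have [_ /(_ B (sub_elt hx)) [ker1 ker2]] := qP.
  split=> [fx0|/ker2 qx1]; first by apply: ker1; rewrite -vq_funE fx0 phi0.
  by apply: phi_inj; rewrite phi0 vq_funE.
have fnat (B D : comAlgType k) (f : {lrmorphism B -> D}) (x : G B) :
    H B x -> vq_fun (points_map G f x) =
      tens_map (idfun : {linear V -> V}) (f : {linear B -> D}) (vq_fun x).
  move=> hx; apply: phi_inj; rewrite phi_natural (vq_funE hx).
  rewrite -group_hom_natural (vq_funE (subpoints_map f hx)).
  by congr (q D _); exact: val_inj.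
have flift (B : comAlgType k) (y : tens V B) :
  exists (D : comAlgType k) (f : {lrmorphism B -> D}) (x : G D), H D x /\
      vq_fun x = tens_map (idfun : {linear V -> V}) (f : {linear B -> D}) y.
  have [ffq _] := qP.
  have [D [f [x xE]]] := faithfully_flat_hom_lift (phi B (y : vect_functor V B)) ffq.
  have hx : H D (val x) := sub_eltP x.
  exists D, f, (val x); split=> //; apply: phi_inj.
  rewrite phi_natural -xE (vq_funE hx).
  by congr (q D _); exact: val_inj.
by exists (VectorQuotient fM fker fnat flift) => B x hx; exact: vq_funE.
Qed.
End Construction.

Lemma vqV (H N : subgroup G) (V : lmodType k) (kap : vector_quotient H N V)
    (B : comAlgType k) (x : G B) : H B x -> kap B (x^-1)%g = - kap B x.
Proof.
move=> hx; apply: (addrI (kap B x)).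
have hV := subpointsV hx.
rewrite -vqM // mulgV subrr; apply/vq_ker; exact: subpoints1.
Qed.
End VectorQuotient.

Section RationalLift.
Variable k : fieldType.

Local Notation vmap V f := (tens_map (idfun : {linear V -> V}) f).

Lemma vmap_comp (W B D E : lmodType k) (f : {linear B -> D}) (g : {linear D -> E})
    (h : {linear B -> E}) : (forall b, g (f b) = h b) ->
  forall x, vmap W g (vmap W f x) = vmap W h x.
Proof. by move=> gfh x; rewrite -tens_map_comp; exact: eq_tens_map. Qed.

(** The maps [F (x) F -> F (x) F (x) F] indexed by the factors that they hit are
    written [a13] and [a23]; the remaining one is the left inclusion. *)
Section Amitsur.
Variables (W : lmodType k) (F : comAlgType k).
Local Notation F2 := (base_tensor F F).
Local Notation F3 := (base_tensor F2 F).
Variables (a13 a23 : {lrmorphism F2 -> F3}).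
Hypothesis a13l : forall x, a13 (base_inl F F x) = base_inl F2 F (base_inl F F x).
Hypothesis a13r : forall x, a13 (base_inr F F x) = base_inr F2 F x.
Hypothesis a23l : forall x, a23 (base_inl F F x) = base_inl F2 F (base_inr F F x).
Hypothesis a23r : forall x, a23 (base_inr F F x) = base_inr F2 F x.

(** Applying a linear form with value 1 at 1 to the third factor of the cocycle
    relation [z_12 + z_23 = z_13] expresses [z] through its own contraction. *)
Lemma additive_cocycle_coboundary (z : tens W F2) :
  vmap W (base_inl F2 F : {linear _ -> _}) z + vmap W (a23 : {linear _ -> _}) z
    = vmap W (a13 : {linear _ -> _}) z ->
  exists w : tens W F, z = vmap W (base_inl F F : {linear _ -> _}) w
                            - vmap W (base_inr F F : {linear _ -> _}) w.
Proof.
have [r r1] := base_functional F.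
have [h hE] := base_tensor_contract F r.
have [h2 h2E] := base_tensor_contract F2 r.
have eq12 : h2 \o base_inl F2 F =1 idfun.
  by move=> t; rewrite /= -[base_inl _ _ t]mulr1 -(rmorph1 (base_inr F2 F)) h2E r1 scale1r.
have eq13 : h2 \o a13 =1 base_inl F F \o h.
  apply: base_tensor_ind => [x y||t u].
  - by rewrite /= rmorphM /= a13l a13r h2E hE linearZZ.
  - by rewrite !raddf0.
  - by move=> /= et eu; rewrite !raddfD /= et eu.
have eq23 : h2 \o a23 =1 base_inr F F \o h.
  apply: base_tensor_ind => [x y||t u].
  - by rewrite /= rmorphM /= a23l a23r h2E hE linearZZ.
  - by rewrite !raddf0.
  - by move=> /= et eu; rewrite !raddfD /= et eu.
move=> /(congr1 (vmap W h2)); rewrite tens_mapD.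
rewrite (vmap_comp (h := idfun) eq12) tens_map_id.
rewrite (vmap_comp (h := base_inl F F \o h) eq13).
rewrite (vmap_comp (h := base_inr F F \o h) eq23) => e.
exists (vmap W h z); apply/eqP; rewrite eq_sym subr_eq; apply/eqP.
rewrite (vmap_comp (h := base_inl F F \o h) (fun=> erefl)).
by rewrite (vmap_comp (h := base_inr F F \o h) (fun=> erefl)) e.
Qed.
End Amitsur.

Variable G : group_functor k.
Variables (H : nat -> subgroup G) (n : nat).
Hypothesis H_decr : forall j, (j < n)%N -> sub_subgroup (H j.+1) (H j).
Hypothesis H_quot : forall j, (j < n)%N ->
  exists W, inhabited (vector_quotient (H j) (H j.+1) W).
Hypothesis H_triv : trivial_subgroup (H n).

Lemma sub_subgroup_le i j : (i <= j <= n)%N -> sub_subgroup (H j) (H i).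
Proof.
case/andP => ij; rewrite -(subnKC ij); elim: (j - i)%N => [|d IHd].
  by rewrite addn0 => _ B x.
rewrite addnS => lt B x /(H_decr lt); exact: IHd (ltnW lt) B x.
Qed.

(** A point over an algebra [F] that is rational up to an error in [H j]. *)
Definition almost_rational (j : nat) (F : comAlgType k) (t : G F) : Prop :=
  H j (base_tensor F F)
    ((points_map G (base_inl F F) t)^-1 * points_map G (base_inr F F) t)%g.

(** The class of the error of [t] in [H j / H j.+1] is an additive cocycle, hence
    the coboundary of some [w]; a local lift [s] of [w] corrects [t]. *)
Lemma almost_rational_next j (F : comAlgType k) (t : G F) : (j < n)%N ->
  almost_rational j t ->
  exists (D : comAlgType k) (f : {lrmorphism F -> D}) (s : G D),
    H j D s /\ almost_rational j.+1 (points_map G f t * s)%g.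
Proof.
move=> ltjn rat_t; have [W [kap]] := H_quot ltjn.
rewrite /almost_rational in rat_t.
set F2 := base_tensor F F in rat_t; set c := (_ * _)%g in rat_t.
pose F3 := base_tensor F2 F.
have [a13 [a13l a13r]] := base_tensor_lift
  (base_inl F2 F \o base_inl F F : {lrmorphism F -> F3}) (base_inr F2 F).
have [a23 [a23l a23r]] := base_tensor_lift
  (base_inl F2 F \o base_inr F F : {lrmorphism F -> F3}) (base_inr F2 F).
have [w zw] : exists w : tens W F, kap F2 c = 
    vmap W (base_inl F F : {linear _ -> _}) w
    - vmap W (base_inr F F : {linear _ -> _}) w.
  apply: (additive_cocycle_coboundary a13l a13r a23l a23r).
  rewrite -!vq_natural // -vqM; try exact: subpoints_map.
  congr (kap _ _); rewrite /c !gmulfM !multV -!points_map_comp.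
  rewrite (eq_points_map _ a13l) (eq_points_map _ a13r).
  by rewrite (eq_points_map _ a23l) (eq_points_map _ a23r) mulgA mulgK.
have [D [f [s [Hs sE]]]] := vq_lift kap w.
exists D, f, s; split=> //; rewrite /almost_rational.
have [g [gl gr]] := base_tensor_lift
  (base_inl D D \o f : {lrmorphism F -> base_tensor D D})
  (base_inr D D \o f : {lrmorphism F -> base_tensor D D}).
set D2 := base_tensor D D in g gl gr *.
have -> : ((points_map G (base_inl D D) (points_map G f t * s))^-1 *
    points_map G (base_inr D D) (points_map G f t * s) =
  (points_map G (base_inl D D) s)^-1 * points_map G g c *
    points_map G (base_inr D D) s)%g.
  rewrite /c !gmulfM multV -!points_map_comp.
  by rewrite (eq_points_map _ gl) (eq_points_map _ gr) invgM !mulgA.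
have Hl : H j D2 ((points_map G (base_inl D D) s)^-1)%g.
  exact/subpointsV/subpoints_map.
have Hc : H j D2 (points_map G g c) by exact: subpoints_map.
have Hr : H j D2 (points_map G (base_inr D D) s) by exact: subpoints_map.
have Hlc := subpointsM Hl Hc.
apply/(vq_ker kap); first exact: subpointsM.
rewrite !vqM // vqV ?vq_natural //; last exact: subpoints_map.
rewrite sE zw tens_mapB (vmap_comp (h := base_inl D D \o f) gl).
rewrite (vmap_comp (h := base_inr D D \o f) gr).
rewrite (vmap_comp (h := base_inl D D \o f) (fun=> erefl)).
rewrite (vmap_comp (h := base_inr D D \o f) (fun=> erefl)).
by rewrite addrA addNr add0r addNr.
Qed.

Variables (i : nat) (V : lmodType k) (kap : vector_quotient (H i) (H i.+1) V).
Hypothesis ltin : (i < n)%N.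
Variables (A : comAlgType k) (u : sub_functor (H i) A).
Hypothesis Hu : represents u.

Lemma almost_rational_lift (v : V) j : (i < j <= n)%N ->
  exists (F : comAlgType k) (t : G F),
    [/\ H i F t, kap F t = tensor v (1 : F) & almost_rational j t].
Proof.
case/andP=> ij; rewrite -(subnKC ij); elim: (j - _)%N => [|d IHd]; last first.
  rewrite addnS => ltn; have [F [t [Ht tE rat_t]]] := IHd (ltnW ltn).
  have [D [f [s [Hs rat_s]]]] := almost_rational_next ltn rat_t.
  have Hs1 : H i.+1 D s.
    by apply: sub_subgroup_le Hs; rewrite leq_addr ltnW.
  have Hsi : H i D s by exact: H_decr Hs1.
  exists D, (points_map G f t * s)%g; split=> //.
    by apply: subpointsM => //; exact: subpoints_map.
  rewrite vqM //; last exact: subpoints_map.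
  rewrite vq_natural // tE tens_map_tensor /= rmorph1.
  by have [_ ->] := vq_ker kap Hsi; rewrite ?addr0.
rewrite addn0 => _.
have [F [f [t [Ht tE]]]] := vq_lift kap (tensor v (1 : k^o)).
have tE1 : kap F t = tensor v 1 by rewrite tE tens_map_tensor /= rmorph1.
exists F, t; split=> //.
have Hl : H i _ (points_map G (base_inl F F) t) by exact: subpoints_map.
have Hr : H i _ (points_map G (base_inr F F) t) by exact: subpoints_map.
have HlV := subpointsV Hl.
apply/(vq_ker kap); first exact: subpointsM.
by rewrite vqM // vqV // !vq_natural // tE1 !tens_map_tensor /= !rmorph1 addNr.
Qed.

(** A lift of [v] whose error lies in the last, trivial, term of the filtration
    has equal pullbacks to [F (x) F], so it descends from [F] to [k]. *)
Lemma rational_lift (v : V) : exists s : G k^o, H i k^o s /\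
  kap k^o s = tensor v (1 : k^o).
Proof.
have [|F [t [Ht tE]]] := @almost_rational_lift v n; first by rewrite ltin /=.
move=> /H_triv lr.
have {}lr : points_map G (base_inl F F) t = points_map G (base_inr F F) t.
  by apply: (mulgI (points_map G (base_inl F F) t)^-1%g); rewrite lr mulVg.
have [|s sE] := points_descent Hu (x := sub_elt Ht) (struct_map_regular_mono F).
  move=> D a b _; apply: val_inj => /=.
  have [m [ml mr]] := base_tensor_lift a b.
  by rewrite -(eq_points_map t ml) -(eq_points_map t mr) !points_map_comp lr.
exists (val s); have Hs := sub_eltP s; split=> //.
have [r r1] := base_functional F.
have rK : r \o @struct_map k F =1 idfun.
  by move=> a; rewrite /= struct_mapE linearZZ r1; exact: mulr1.
have vK : cancel (vmap V (@struct_map k F : {linear k^o -> F})) (vmap V r).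
  by move=> x; rewrite (vmap_comp (h := idfun) rK) tens_map_id.
apply: (can_inj vK); rewrite -vq_natural // tens_map_tensor /= rmorph1 -tE.
by congr (kap F _); rewrite -[RHS]/(val (sub_elt Ht)) -sE.
Qed.
End RationalLift.

(** * Levi factors as sections *)

Section LeviSection.
Variables (k : fieldType) (G Gred : group_functor k) (pi : group_hom G Gred).
Variables (R : subgroup G) (hpi : is_quotient pi R).
Variables (L : subgroup G) (hL : levi_factor R L).

Let kerP (B : comAlgType k) (x : G B) : pi B x = 1%g <-> R B x.
Proof. by have [_] := hpi; apply. Qed.

Lemma levi_inj (B : comAlgType k) (x y : G B) :
  L B x -> L B y -> pi B x = pi B y -> x = y.
Proof.
move=> Lx Ly exy; have [_ /(_ B) /bij_inj inj] := hL.
have Rxy : R B (y^-1 * x)%g.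
  by apply/kerP; rewrite gmulfM multV exy mulVg.
have := inj (sub_elt Lx, sub_elt (subpoints1 R B)) (sub_elt Ly, sub_elt Rxy).
by rewrite /= mulg1 mulVKg => /(_ erefl) [].
Qed.

Lemma levi_part_exists (B : comAlgType k) (x : G B) :
  exists l, L B l /\ pi B l = pi B x.
Proof.
have [_ /(_ B) [h _ hK]] := hL.
exists (val (h x).1); split; first exact: sub_eltP.
have /kerP r1 := sub_eltP (h x).2.
by rewrite -[in RHS](hK x) gmulfM r1 mulg1.
Qed.

(** The [L]-part of a point of [G] depends on its image in [Gred] only, so that
    of the universal point of [G] descends to the algebra of [Gred]. *)
Lemma levi_surj (B : comAlgType k) (y : Gred B) : exists l, L B l /\ pi B l = y.
Proof.
have [[A [u [C [w [f [Gu Qw wu ff]]]]]] _] := hpi.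
have [l [Ll lE]] := levi_part_exists u.
have reg := faithfully_flat_regular_mono ff.
have [|s sE] := points_descent Gu (x := l) reg.
  move=> D i j ij; apply: levi_inj; try exact: subpoints_map.
  by rewrite !group_hom_natural lE -wu; exact: points_mapA.
have piS : pi C s = w.
  apply: (points_map_inj Qw reg.1).
  by rewrite -group_hom_natural sE lE -wu.
have [g [gw _]] := Qw B y.
have [l' [Ll' lE']] := levi_part_exists (points_map G g s).
by exists l'; split=> //; rewrite lE' group_hom_natural piS.
Qed.

(** The section lands in [L], hence the points of [L] are those that it fixes. *)
Lemma levi_section : exists sigma : group_hom Gred G,
  (forall (B : comAlgType k) (y : Gred B), pi B (sigma B y) = y) /\
  (forall (B : comAlgType k) (x : G B), L B x <-> sigma B (pi B x) = x).
Proof.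
pose s (B : comAlgType k) (y : Gred B) : G B := sval (cid (levi_surj y)).
have Ls (B : comAlgType k) (y : Gred B) : L B (s B y).
  by rewrite /s; case: cid => ? [].
have pis (B : comAlgType k) (y : Gred B) : pi B (s B y) = y.
  by rewrite /s; case: cid => ? [].
have sM (B : comAlgType k) : {morph s B : x y / (x * y)%g}.
  move=> x y; apply: levi_inj => //; first exact: subpointsM.
  by rewrite gmulfM !pis.
pose sigma0 (B : comAlgType k) : {multiplicative Gred B -> G B} :=
  HB.pack (s B) (isMultiplicative.Build _ _ (s B) (sM B)).
have nat (B C : comAlgType k) (f : {lrmorphism B -> C}) (x : Gred B) :
  sigma0 C (points_map Gred f x) = points_map G f (sigma0 B x).
  apply: levi_inj; [exact: Ls | exact/subpoints_map/Ls |].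
  by rewrite group_hom_natural !pis.
exists (GroupHom nat); split=> [B y|B x]; first exact: pis.
split=> [Lx|<-]; last exact: Ls.
by apply: levi_inj => //; [exact: Ls | exact: pis].
Qed.
End LeviSection.

(** * Conjugating sections *)

Section Conjugation.
Variables (k : fieldType) (G Gred : group_functor k) (pi : group_hom G Gred).
Variables (sigma sigma' : group_hom Gred G).
Hypothesis sigmaK : forall (B : comAlgType k) (y : Gred B), pi B (sigma B y) = y.

Definition base_point (r : G k^o) (B : comAlgType k) : G B :=
  points_map G (@struct_map k B : {lrmorphism k^o -> B}) r.

Lemma base_point_natural r (B D : comAlgType k) (f : {lrmorphism B -> D}) :
  points_map G f (base_point r B) = base_point r D.
Proof.
rewrite /base_point -points_map_comp; apply: eq_points_map => a.
exact: lrmorph_struct.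
Qed.

Definition twist (r : G k^o) (B : comAlgType k) (y : Gred B) : G B :=
  (base_point r B * sigma B y * (base_point r B)^-1)%g.

(** What separates [sigma'] from the conjugate of [sigma] by [r]. *)
Definition discrepancy (r : G k^o) (B : comAlgType k) (y : Gred B) : G B :=
  (sigma' B y * (twist r y)^-1)%g.

Lemma twistM r (B : comAlgType k) : {morph @twist r B : x y / (x * y)%g}.
Proof. by move=> x y; rewrite /twist gmulfM !mulgA mulgVK. Qed.

Lemma discrepancy_natural r (B D : comAlgType k) (f : {lrmorphism B -> D}) y :
  points_map G f (discrepancy r y) = discrepancy r (points_map Gred f y).
Proof.
by rewrite !(gmulfM, multV) !base_point_natural -!group_hom_natural.
Qed.

Lemma discrepancyM r (B : comAlgType k) (x y : Gred B) :
  discrepancy r (x * y)%g =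
  (discrepancy r x * (twist r x * discrepancy r y * (twist r x)^-1))%g.
Proof.
rewrite /discrepancy twistM gmulfM invgM.
by move: (twist r x) (twist r y) => t t'; rewrite !mulgA mulgVK.
Qed.

Lemma twist_conj r s (B : comAlgType k) (y : Gred B) :
  twist (s^-1 * r)%g y = ((base_point s B)^-1 * twist r y * base_point s B)%g.
Proof. by rewrite /twist /base_point gmulfM multV invgM invgK !mulgA. Qed.

Variables (H N : subgroup G) (V : representation Gred).
Variable kap : vector_quotient H N V.
Hypothesis H_normal : normal_subgroup H.
Hypothesis kap_conj : forall (B : comAlgType k) (g x : G B), H B x ->
  kap B (g * x * g^-1)%g = rep_act V (pi B g) (kap B x).
Hypothesis kap_lift : forall v : V,
  exists s : G k^o, H k^o s /\ kap k^o s = tensor v (1 : k^o).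
Hypothesis H1V : cohomology_vanishes 1 V.

(** The class of the discrepancy in [H / N] is a crossed homomorphism, so it equals
    [y |-> y v - v]; conjugating further by the inverse of a rational lift of [v]
    cancels it. *)
Lemma conjugate_step (r : G k^o) : pi k^o r = 1%g ->
  (forall (B : comAlgType k) (y : Gred B), H B (discrepancy r y)) ->
  exists s : G k^o, H k^o s /\
    forall (B : comAlgType k) (y : Gred B), N B (discrepancy (s^-1 * r)%g y).
Proof.
move=> pi_r Hd.
have pi_twist (B : comAlgType k) (y : Gred B) : pi B (twist r y) = y.
  rewrite !(gmulfM, multV) /base_point group_hom_natural pi_r mult1.
  by rewrite mul1g invg1 mulg1 sigmaK.
pose c (B : comAlgType k) (y : Gred B) := kap B (discrepancy r y).
have cP : crossed_hom c.
  split=> [B g h|B D f g]; rewrite /c; last first.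
    by rewrite -discrepancy_natural vq_natural.
  rewrite discrepancyM vqM ?kap_conj ?pi_twist //; exact: H_normal.
have [v vE] := crossed_hom_principal cP H1V.
have [s [Hs sE]] := kap_lift v; exists s; split=> // B y.
set sB := base_point s B; set t := twist r y.
have HsB : H B sB by exact: subpoints_map.
have sBE : kap B sB = tensor v 1.
  by rewrite vq_natural // sE tens_map_tensor /= rmorph1.
have -> : discrepancy (s^-1 * r)%g y =
    (discrepancy r y * (t * sB^-1 * t^-1) * sB)%g.
  rewrite /discrepancy twist_conj -/sB -/t; move: t => t.
  by rewrite !invgM invgK !mulgA mulgVK.
have HV := subpointsV HsB; have Hc := H_normal t HV.
have Hdc := subpointsM (Hd B y) Hc.
apply/(vq_ker kap); first exact: subpointsM.
rewrite vqM // vqM // kap_conj // vqV // pi_twist sBE raddfN -/(c B y) vE.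
by rewrite addrAC subrK addrN.
Qed.
End Conjugation.

Theorem theorem5p1 (k : fieldType)
    (K : closedFieldType) (iota : {rmorphism k -> K})
    (hK : is_algebraic_closure iota)
    (G : group_functor k) (hG : linear_algebraic_group G)
    (hGc : connected_group G)
    (R : subgroup G) (Gred : group_functor k) (pi : group_hom G Gred)
    (hpi : is_quotient pi R)
    (hL : condition_L iota R pi)
    (S : linearizable_splitting_sequence R pi)
    (V : 'I_(ss_length S) -> representation Gred)
    (phi : forall i : 'I_(ss_length S),
      group_hom (vect_functor (V i)) (ss_quot S i))
    (hphi : forall i : 'I_(ss_length S),
      equivariant_iso (lss_action S i) (phi i))
    (hLevi : exists M : subgroup G, levi_factor R M)
    (hH1 : forall i : 'I_(ss_length S), cohomology_vanishes 1 (V i)) :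
  forall L L' : subgroup G, levi_factor R L -> levi_factor R L' ->
    exists r : G k^o, R k^o r /\ conjugate_by r L L'.
Proof.
move=> L L' /(levi_section hpi)[sigma [sigmaK LE]].
move=> /(levi_section hpi)[sigma' [sigmaK' LE']].
have kerP (B : comAlgType k) (x : G B) : pi B x = 1%g <-> R B x.
  by have [_] := hpi; apply.
have H_decr := @ss_decr _ _ _ S.
have kapP (i : 'I_(ss_length S)) :=
  vector_quotient_exists (ss_quotient i) (hphi i).1.
have H_quot j : (j < ss_length S)%N ->
    exists W, inhabited (vector_quotient (ss_term S j) (ss_term S j.+1) W).
  by move=> ltj; have [kap _] := kapP (Ordinal ltj); exists (V (Ordinal ltj)).
have HR j : (j <= ss_length S)%N -> sub_subgroup (ss_term S j) R.
  move=> lej B x Hx; apply/(ss_first S).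
  exact: (sub_subgroup_le H_decr (i := 0) _ Hx).
have conj j : (j <= ss_length S)%N -> exists r : G k^o, R k^o r /\
    forall (B : comAlgType k) (y : Gred B),
      ss_term S j B (discrepancy sigma sigma' r y).
  elim: j => [_|j IHj ltj].
    exists 1%g; split=> [|B y]; first exact: subpoints1.
    apply/(ss_first S)/kerP.
    rewrite /discrepancy /twist /base_point mult1 mul1g invg1 mulg1.
    by rewrite gmulfM multV sigmaK sigmaK' mulgV.
  have [r [Rr Hr]] := IHj (ltnW ltj); pose i := Ordinal ltj.
  have [kap kapE] := kapP i.
  have Hnormal := ss_normal (ltnW ltj : (i <= ss_length S)%N).
  have kap_conj (B : comAlgType k) (g x : G B) : ss_term S i B x ->
      kap B (g * x * g^-1)%g = rep_act (V i) (pi B g) (kap B x).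
    move=> Hx; have Hgx := Hnormal B g x Hx.
    apply: (phi_inj (hphi i).1); rewrite (kapE _ _ Hgx) (hphi i).2 (kapE _ _ Hx).
    by rewrite (@lss_action_conj _ _ _ _ _ S i B g (sub_elt Hx) (sub_elt Hgx)).
  have [[A [u [_ [_ [_ [Hu _ _ _]]]]]] _] := ss_quotient i.
  have kap_lift := rational_lift H_decr H_quot (@ss_last _ _ _ S) kap ltj Hu.
  have /kerP pir := Rr.
  have [s [Hs Ns]] :=
    conjugate_step sigmaK Hnormal kap_conj kap_lift (hH1 i) pir Hr.
  exists (s^-1 * r)%g; split=> //; apply: subpointsM => //.
  exact/subpointsV/(HR _ (ltnW ltj)).
have [r [Rr Hr]] := conj _ (leqnn _).
exists r; split=> // B x; rewrite /= -/(base_point r B).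
have pir : pi B (base_point r B) = 1%g.
  by rewrite /base_point group_hom_natural (kerP _ _).2 // mult1.
have sigmaE y : sigma' B y = twist sigma r y.
  by apply/eqP; rewrite -divg_eq1; apply/eqP/(ss_last S); exact: Hr.
have pix : pi B (base_point r B * x * (base_point r B)^-1)%g = pi B x.
  by rewrite !gmulfM multV pir mul1g invg1 mulg1.
split=> [/LE Lx|/LE' Lx].
  by apply/LE'; rewrite pix sigmaE /twist Lx.
apply/LE; move: Lx; rewrite pix sigmaE /twist.
by move=> /mulIg/mulgI.
Qed.
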